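(* Let $\mathbb{T}$ be a time scale, $a,b\in\mathbb{T}$ with $a<b$, let $\alpha,\beta,\Lambda$ be given real numbers, and let $f,g:[a,b]\times\mathbb{R}\times\mathbb{R}\to\mathbb{R}$, $(t,x,v)\mapsto f(t,x,v)$ and $(t,x,v)\mapsto g(t,x,v)$, have continuous partial derivatives $f_x,f_v,g_x,g_v$ with respect to the second and third variables. If $y\in\mathcal{C}^1([a,b],\mathbb{R})$ is a local minimizer or local maximizer for $$I[y]=\int_a^b f(t,y^\rho(t),y^\nabla(t))\,\nabla t$$ subject to the boundary conditions $y(a)=\alpha$, $y(b)=\beta$ and to the integral constraint $$J[y]=\int_a^b g(t,y^\rho(t),y^\nabla(t))\,\nabla t=\Lambda ,$$ then there exist two real constants $\lambda_0$ and $\lambda$, not both zero, such that, with $K=\lambda_0 f-\lambda g$, $$K_v^\nabla(t,y^\rho(t),y^\nabla(t))-K_x(t,y^\rho(t),y^\nabla(t))=0$$ for all $t\in[a,b]_\kappa$.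
   Context: A time scale $\mathbb{T}$ is a nonempty closed subset of $\mathbb{R}$. Throughout, $[a,b]$ denotes $[a,b]\cap\mathbb{T}$, itself regarded as a time scale on which the operators below are taken. The backward jump operator is $\rho(t)=\sup\{s\in[a,b]: s<t\}$ for $t\neq a$, and $\rho(a)=a$. The forward jump operator is $\sigma(t)=\inf\{s\in[a,b]:s>t\}$ for $t\ne b$, and $\sigma(b)=b$. The point $a$ is right-scattered if $\sigma(a)>a$; $[a,b]_\kappa=[a,b]\setminus\{a\}$ if $a$ is right-scattered, and $[a,b]_\kappa=[a,b]$ otherwise. A function $h:[a,b]\to\mathbb{R}$ is nabla differentiable at $t\in[a,b]_\kappa$ if there is a number $h^\nabla(t)$ (the nabla derivative) such that for every $\epsilon>0$ there is a neighborhood $U$ of $t$ in $[a,b]$ with $|h(\rho(t))-h(s)-h^\nabla(t)(\rho(t)-s)|\le\epsilon|\rho(t)-s|$ for all $s\in U$. Notation: $h^\rho=h\circ\rho$. $\mathcal{C}^1([a,b],\mathbb{R})$ is the set of $y:[a,b]\to\mathbb{R}$ such that $y^\nabla$ exists and is continuous on $[a,b]_\kappa$. A nabla antiderivative of $h$ is a function $H$ with $H^\nabla(t)=h(t)$ for all $t\in[a,b]_\kappa$, and the nabla integral is $\int_r^s h(t)\nabla t=H(s)-H(r)$. $K_x,K_v$ are the partial derivatives of $K(t,x,v)$ with respect to the second and third variables, and $K_v^\nabla(t,y^\rho(t),y^\nabla(t))$ denotes the nabla derivative at $t$ of the composite function $t\mapsto K_v(t,y^\rho(t),y^\nabla(t))$.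 Local extremizer: a function $y\in\mathcal{C}^1([a,b],\mathbb{R})$ satisfying the boundary conditions and the integral constraint is a local minimizer (respectively local maximizer) if there is $\delta>0$ such that $I[y]\le I[\hat y]$ (respectively $I[y]\ge I[\hat y]$) for all $\hat y\in\mathcal{C}^1([a,b],\mathbb{R})$ satisfying $\hat y(a)=\alpha$, $\hat y(b)=\beta$, $J[\hat y]=\Lambda$ and $\|\hat y^\rho-y^\rho\|+\|\hat y^\nabla-y^\nabla\|<\delta$, where $\|h\|=\sup_{t\in[a,b]_\kappa}|h(t)|$.
   Formalization: If a is right-scattered, K_v(t,y^ρ,y^∇) is undefined at a, so its nabla derivative at σ(a) is too; the equation is stated for all t in [a,b]_κ with the composite given some unspecified real value c at a, which affects only t=σ(a). *)

(* Defs.v *)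
(* Mathematical Components with MathComp-Analysis; R : realType is the real line. *)
From HB Require Import structures.
From mathcomp Require Import all_boot all_order all_algebra.
From mathcomp Require Import all_classical all_reals all_analysis.

Set Implicit Arguments.
Unset Strict Implicit.
Unset Printing Implicit Defensive.

Import Order.TTheory GRing.Theory Num.Theory.
Import numFieldNormedType.Exports.

Local Open Scope classical_set_scope.
Local Open Scope ring_scope.

(* Functions on [a, b] `&` T are represented by total functions R -> R (and
   Lagrangians by total functions R -> R -> R -> R); none of the definitions
   below depends on their values at times outside [a, b] `&` T. *)

Definition time_scale (R : realType) (T : set R) : Prop :=
  T !=set0 /\ closed T.

Definition ts_itv (R : realType) (T : set R) (a b : R) : set R :=
  T `&` [set t | a <= t <= b].

Definition rho (R : realType) (T : set R) (a b t : R) : R :=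
  if t == a then a else sup [set s | ts_itv T a b s /\ s < t].

Definition sigma (R : realType) (T : set R) (a b t : R) : R :=
  if t == b then b else inf [set s | ts_itv T a b s /\ t < s].

Definition kappa (R : realType) (T : set R) (a b : R) : set R :=
  if a < sigma T a b a then ts_itv T a b `\ a else ts_itv T a b.

Definition is_nabla_derivative (R : realType) (T : set R) (a b : R)
    (h : R -> R) (t d : R) : Prop :=
  forall eps : R, 0 < eps ->
    \forall s \near within (ts_itv T a b) (nbhs t),
      `|h (rho T a b t) - h s - d * (rho T a b t - s)|
        <= eps * `|rho T a b t - s|.

Definition nabla_derivable (R : realType) (T : set R) (a b : R)
    (h : R -> R) (t : R) : Prop :=
  exists d : R, is_nabla_derivative T a b h t d.

(* Meaningful only where h is nabla derivable and t lies in kappa T a b, in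
   which case the derivative is unique; an arbitrary real otherwise. *)
Definition nabla (R : realType) (T : set R) (a b : R) (h : R -> R) (t : R) : R :=
  get [set d : R | is_nabla_derivative T a b h t d].

Definition C1_nabla (R : realType) (T : set R) (a b : R) (y : R -> R) : Prop :=
  (forall t, kappa T a b t -> nabla_derivable T a b y t) /\
  {within kappa T a b, continuous (nabla T a b y)}.

Definition nabla_antiderivative (R : realType) (T : set R) (a b : R)
    (h H : R -> R) : Prop :=
  forall t, kappa T a b t -> is_nabla_derivative T a b H t (h t).

Definition nabla_integrable (R : realType) (T : set R) (a b : R)
    (h : R -> R) : Prop :=
  exists H : R -> R, nabla_antiderivative T a b h H.

(* The integral over the whole of [a, b] `&` T; two antiderivatives differ by a
   constant, so the choice of H is immaterial.  An arbitrary real if h is not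
   nabla integrable. *)
Definition nabla_integral (R : realType) (T : set R) (a b : R)
    (h : R -> R) : R :=
  get [set v : R |
    exists H : R -> R, nabla_antiderivative T a b h H /\ v = H b - H a].

Definition nabla_norm (R : realType) (T : set R) (a b : R) (h : R -> R) : R :=
  sup [set `|h t| | t in kappa T a b].

Definition partial_x (R : realType) (f : R -> R -> R -> R) (t x v : R) : R :=
  derive1 (fun z => f t z v) x.

Definition partial_v (R : realType) (f : R -> R -> R -> R) (t x v : R) : R :=
  derive1 (fun z => f t x z) v.

Definition continuous_partials (R : realType) (T : set R) (a b : R)
    (f : R -> R -> R -> R) : Prop :=
  let D := [set p : R * R * R | ts_itv T a b p.1.1] in
  (forall t x v, ts_itv T a b t ->
     derivable (fun z => f t z v) x 1 /\ derivable (fun z => f t x z) v 1) /\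
  {within D, continuous (fun p : R * R * R => partial_x f p.1.1 p.1.2 p.2)} /\
  {within D, continuous (fun p : R * R * R => partial_v f p.1.1 p.1.2 p.2)}.

Definition along (R : realType) (T : set R) (a b : R)
    (f : R -> R -> R -> R) (y : R -> R) (t : R) : R :=
  f t (y (rho T a b t)) (nabla T a b y t).

Definition functional (R : realType) (T : set R) (a b : R)
    (f : R -> R -> R -> R) (y : R -> R) : R :=
  nabla_integral T a b (along T a b f y).

(* f and g need not be continuous in t, so the integrals I[y] and J[y] might
   not exist; a competitor is a function for which both do. *)
Definition admissible (R : realType) (T : set R) (a b alpha beta Lambda : R)
    (f g : R -> R -> R -> R) (y : R -> R) : Prop :=
  [/\ C1_nabla T a b y,
      y a = alpha /\ y b = beta,
      nabla_integrable T a b (along T a b f y),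
      nabla_integrable T a b (along T a b g y) &
      functional T a b g y = Lambda].

Definition C1_dist (R : realType) (T : set R) (a b : R) (z y : R -> R) : R :=
  nabla_norm T a b (fun t => z (rho T a b t) - y (rho T a b t)) +
  nabla_norm T a b (fun t => nabla T a b z t - nabla T a b y t).

Definition local_minimizer (R : realType) (T : set R)
    (a b alpha beta Lambda : R) (f g : R -> R -> R -> R) (y : R -> R) : Prop :=
  admissible T a b alpha beta Lambda f g y /\
  exists delta : R, 0 < delta /\
    forall z : R -> R, admissible T a b alpha beta Lambda f g z ->
      C1_dist T a b z y < delta ->
      functional T a b f y <= functional T a b f z.

Definition local_maximizer (R : realType) (T : set R)
    (a b alpha beta Lambda : R) (f g : R -> R -> R -> R) (y : R -> R) : Prop :=
  admissible T a b alpha beta Lambda f g y /\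
  exists delta : R, 0 < delta /\
    forall z : R -> R, admissible T a b alpha beta Lambda f g z ->
      C1_dist T a b z y < delta ->
      functional T a b f z <= functional T a b f y.

(* t |-> K_v(t, y^rho(t), y^nabla(t)) is defined on kappa T a b only, because
   y^nabla is.  When a is right-scattered, its nabla derivative at sigma(a)
   nevertheless refers to the value at rho(sigma(a)) = a, which has to be
   supplied; c is that value.  It is used at no t in kappa T a b, and it affects
   the nabla derivative at no point of kappa T a b other than sigma(a).  When a
   is not right-scattered, c plays no role. *)
Definition extend_to_a (R : realType) (T : set R) (a b : R)
    (k : R -> R) (c t : R) : R :=
  if t \in kappa T a b then k t else c.

Definition euler_lagrange (R : realType) (T : set R) (a b : R)
    (K : R -> R -> R -> R) (y : R -> R) : Prop :=
  exists c : R, forall t, kappa T a b t ->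
    let Kv := extend_to_a T a b (along T a b (partial_v K) y) c in
    nabla_derivable T a b Kv t /\
    nabla T a b Kv t - along T a b (partial_x K) y t = 0.

(* Main.v *)
Require Import Defs.
From HB Require Import structures.
From mathcomp Require Import all_boot all_order all_algebra.
From mathcomp Require Import all_classical all_reals all_analysis.
From mathcomp Require Import ring lra.

Set Implicit Arguments.
Unset Strict Implicit.
Unset Printing Implicit Defensive.

Import Order.TTheory GRing.Theory Num.Theory.
Import numFieldNormedType.Exports.

Local Open Scope classical_set_scope.
Local Open Scope ring_scope.

(* The variations y + u w1 + v w2 turn I and J into functions of (u, v) that are
   differentiable at the origin.  If the first variation of J vanishes on w1 but
   not on w2, the intermediate value theorem applied in v to the constraint
   yields admissible competitors with v = o(u), so the first variation of I
   vanishes on w1 as well.  Hence the two first variations are proportional, and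
   some nontrivial combination, the first variation of K, vanishes identically.
   After an integration by parts, K_v minus an antiderivative of K_x is
   orthogonal to the derivative of every variation, and the lemma of du
   Bois-Reymond makes it constant.  The antiderivatives needed exist because the
   integrands are bounded and continuous at left-dense points. *)

(** Three obstacles shape the argument. At a point that is left-scattered and right-dense [rho]
    jumps, so [y] composed with [rho] is in general discontinuous there even for smooth [y];
    integrands can only be controlled at points with [rho t = t], and antiderivatives have to be
    built for that class. Next, [f] and [g] may be irregular in [t], so their integrals along a
    function need not exist; integrability is known at the extremizer and is carried to its
    variations through the increments, whose dependence on [t] is governed by the continuous partial
    derivatives. Finally, only a first order expansion at the origin is established for the
    functions of [(u, v)], together with a Lipschitz bound in [v]; this is too little for the
    implicit function theorem, but enough for intermediate values. The product rule in the form
    [d * k (r t) + h t * e] decides which integration by parts is possible: an antiderivative [G] of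
    [K_x], evaluated at [t] and not at [rho t], absorbs exactly the term carrying [w (rho t)]. *)

Lemma near_withinP (R : realType) (A : set R) (t : R) (P : R -> Prop) :
  (\forall s \near within A (nbhs t), P s) <->
  exists2 e : R, 0 < e & forall s, A s -> `|s - t| < e -> P s.
Proof.
rewrite near_withinE near_simpl; split.
  move=> /nbhs_ballP[e /= e0 he]; exists e => // s As st.
  by apply: he => //; rewrite /ball /= distrC.
move=> [e e0 he]; apply/nbhs_ballP; exists e => //= s st As.
by apply: he => //; rewrite distrC.
Qed.

Lemma cvg_withinP (R : realType) (A : set R) (t : R) (h : R -> R) (l : R) :
  h @ within A (nbhs t) --> l <->
  forall e : R, 0 < e ->
    exists2 d : R, 0 < d & forall s, A s -> `|s - t| < d -> `|h s - l| <= e.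
Proof.
split=> [/cvgrPdist_le H e /H /near_withinP [d d0 hd]|H].
  by exists d => // s As st; rewrite distrC; apply: hd.
apply/cvgrPdist_le => e /H [d d0 hd]; apply/near_withinP; exists d => // s As st.
by rewrite distrC; apply: hd.
Qed.

(** * Backward jump and topology of the truncated time scale *)

Definition ts_setting (R : realType) (T : set R) (a b : R) : Prop :=
  [/\ closed T, T a, T b & a < b].

Section jump_operators.
Context {R : realType} {T : set R} {a b : R} (ts : ts_setting T a b).
Local Notation I := (ts_itv T a b).
Local Notation K := (kappa T a b).
Local Notation r := (rho T a b).

Lemma ts_lt : a < b. Proof. by case: ts. Qed.

Lemma ts_itv_a : I a. Proof. by case: ts => _ Ta _ /ltW ?; split; rewrite //= lexx. Qed.

Lemma ts_itv_b : I b. Proof. by case: ts => _ _ Tb /ltW ?; split; rewrite //= lexx andbT. Qed.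

Lemma ts_itv_ge s : I s -> a <= s. Proof. by move=> [_ /andP[]]. Qed.

Lemma ts_itv_le s : I s -> s <= b. Proof. by move=> [_ /andP[]]. Qed.

Lemma closed_ts_itv : closed I.
Proof.
have [clT _ _ _] := ts.
rewrite (_ : I = T `&` ([set t | a <= t] `&` [set t | t <= b])).
  by apply: closedI => //; apply: closedI; [exact: closed_ge|exact: closed_le].
by apply/seteqP; split=> t [Tt] => [/andP[]|[? ?]] //; split=> //; apply/andP.
Qed.

Lemma sup_ts_itv (A : set R) : A `<=` I -> A !=set0 -> I (sup A).
Proof.
move=> AI A0; have ubA : has_ubound A by exists b => s /AI /ts_itv_le.
apply: closed_ts_itv; apply: (closureS AI); exact: closure_sup.
Qed.

Lemma inf_ts_itv (A : set R) : A `<=` I -> A !=set0 -> I (inf A).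
Proof.
move=> AI A0; have infA : has_inf A by split=> //; exists a => s /AI /ts_itv_ge.
apply: closed_ts_itv => B /nbhs_ballP[e /= e0 he].
have [x Ax xe] := inf_adherent e0 infA.
have le_x : inf A <= x by apply: ge_inf; first by case: infA.
exists x; split; first exact: AI.
by apply: he; rewrite /ball /= distrC ger0_norm; lra.
Qed.

Lemma rho_a : r a = a. Proof. by rewrite /rho eqxx. Qed.

(** The two cases are left-scattered and left-dense points. The supremum defining [rho] lies in the
    closed set [I]; if it is below [t] it is the predecessor of [t], otherwise it is [t] and points
    of [I] approximate it from the left. *)
Lemma rhoP t : I t -> t != a ->
  [/\ r t < t, I (r t) & forall s, I s -> s < t -> s <= r t] \/
  (r t = t /\ forall e, 0 < e -> exists s, [/\ I s, t - e < s & s < t]).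
Proof.
move=> It ta; rewrite /rho (negbTE ta); set A := [set s | _].
have ta' : a < t by rewrite lt_neqAle eq_sym ta ts_itv_ge.
have A0 : A !=set0 by exists a; split=> //; exact: ts_itv_a.
have ubA : ubound A t by move=> s [_ /ltW].
have hs : has_sup A by split=> //; exists t.
have IA : I (sup A) by apply: sup_ts_itv A0 => s [].
have le_sup s : I s -> s < t -> s <= sup A.
  by move=> Is st; apply: (sup_upper_bound hs).
have : sup A <= t by exact: ge_sup.
rewrite le_eqVlt => /predU1P[supE|lt]; [right|by left; split].
split=> // e /sup_adherent-/(_ _ hs)[s [Is st]]; rewrite supE => es.
by exists s.
Qed.

Lemma rho_ts_itv t : I t -> I (r t).
Proof.
move=> It; have [->|ta] := eqVneq t a; first by rewrite rho_a; exact: ts_itv_a.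
by have [[]//|[-> _]] := rhoP It ta.
Qed.

Lemma rho_le t : I t -> r t <= t.
Proof.
move=> It; have [->|ta] := eqVneq t a; first by rewrite rho_a.
by have [[/ltW]//|[-> _]] := rhoP It ta.
Qed.

Lemma le_rho s t : I s -> I t -> s < t -> s <= r t.
Proof.
move=> Is It st; have ta : t != a.
  by rewrite gt_eqF// (le_lt_trans _ st)// ts_itv_ge.
by have [[_ _]|[-> _]] := rhoP It ta; [exact|exact: ltW].
Qed.

(** Trades the infimum in [sigma] for points of [I] accumulating at [a] from the right, the form in
    which membership of [a] is used later. *)
Lemma kappaP t :
  K t <-> I t /\ (t = a -> forall e, 0 < e -> exists s, [/\ I s, a < s & s < a + e]).
Proof.
rewrite /kappa /sigma (lt_eqF ts_lt); set A := [set s | _].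
have A0 : A !=set0 by exists b; split; [exact: ts_itv_b|exact: ts_lt].
have lbA : lbound A a by move=> s [_ /ltW].
have hi : has_inf A by split=> //; exists a.
have : a <= inf A by exact: lb_le_inf.
rewrite le_eqVlt => /predU1P[infE|lt].
  rewrite -infE ltxx; split=> [It|[]//]; split=> // _ e e0.
  have [s [Is st]] := inf_adherent e0 hi; rewrite -infE => es.
  by exists s.
rewrite lt; split=> [[It /eqP ta]|[It H]]; first by split=> // /eqP; rewrite (negbTE ta).
split=> // tE; have e0 : 0 < inf A - a by rewrite subr_gt0.
have [s [Is sa se]] := H tE _ e0.
have : inf A <= s by apply: ge_inf => //; exists a.
by move: se; rewrite addrC subrK ltNge => /negP.
Qed.

Lemma kappa_ts_itv t : K t -> I t. Proof. by move=> /kappaP[]. Qed.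

Lemma gt_kappa s t : I s -> I t -> s < t -> K t.
Proof.
move=> Is It st; apply/kappaP; split=> // ta.
by move: st; rewrite ta ltNge ts_itv_ge.
Qed.

Lemma kappa_b : K b. Proof. exact: gt_kappa ts_itv_a ts_itv_b ts_lt. Qed.

Lemma notin_kappa t : I t -> ~ K t -> t = a.
Proof.
move=> It nKt; have [//|ta] := eqVneq t a; case: nKt; apply: (gt_kappa ts_itv_a It).
by rewrite lt_neqAle eq_sym ta ts_itv_ge.
Qed.

(** If [a] is a limit of points of [K], either [a] is one of them or points of [I] beyond [a] come
    arbitrarily near, and [a] is then right-dense. Closedness gives compactness, hence bounds for
    functions continuous on [K]. *)
Lemma closed_kappa : closed K.
Proof.
move=> t clt; have It : I t.
  by apply: closed_ts_itv; apply: closureS clt; exact: kappa_ts_itv.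
apply/kappaP; split=> // ta e e0.
have [s [Ks]] := clt _ (nbhsx_ballx t e e0).
rewrite /ball /= ta => se; have Is := kappa_ts_itv Ks.
move: Ks => /kappaP[_]; have [sa /(_ sa e e0)//|sa _] := eqVneq s a.
have sa' : a < s by rewrite lt_neqAle eq_sym sa ts_itv_ge.
by exists s; split=> //; move: se; rewrite ltr_norml => /andP[? ?]; lra.
Qed.

Lemma compact_ts_itv : compact I.
Proof.
apply: (subclosed_compact closed_ts_itv (@segment_compact _ a b)) => t [_].
by rewrite /= in_itv.
Qed.

Lemma compact_kappa : compact K.
Proof. exact: subclosed_compact closed_kappa compact_ts_itv kappa_ts_itv. Qed.

(** To the right of a nearby point [u < t] of [I], [r s] is squeezed between [u] and [s]; at [t = a]
    the end point itself is the lower bound. At a left-scattered, right-dense point this continuity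
    fails. *)
Lemma rho_near t : K t -> r t = t ->
  forall e, 0 < e -> exists2 d, 0 < d & forall s, I s -> `|s - t| < d -> `|r s - t| < e.
Proof.
move=> Kt rt e e0; have It := kappa_ts_itv Kt.
have [ta|ta] := eqVneq t a.
  exists e => // s Is; have := ts_itv_ge (rho_ts_itv Is); have := rho_le Is.
  by rewrite ta !ltr_norml => ? ? /andP[? ?]; apply/andP; split; lra.
have [[]|[_ /(_ e e0)[u [Iu ue ut]]]] := rhoP It ta; first by rewrite rt ltxx.
have d0 : 0 < Num.min e (t - u) by rewrite lt_min e0 subr_gt0.
exists (Num.min e (t - u)) => // s Is.
rewrite lt_min !ltr_norml => /andP[/andP[? ?] /andP[? ?]].
have us : u < s by lra.
by have := le_rho Iu Is us; have := rho_le Is; move=> ? ?; apply/andP; split; lra.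
Qed.

End jump_operators.

(** * Rules of the nabla derivative and mean value inequalities *)

Section nabla_calculus.
Context {R : realType} {T : set R} {a b : R} (ts : ts_setting T a b).
Local Notation I := (ts_itv T a b).
Local Notation K := (kappa T a b).
Local Notation r := (rho T a b).
Local Notation deriv := (is_nabla_derivative T a b).
Local Notation anti := (nabla_antiderivative T a b).

(* Carathéodory's form of the nabla derivative: it turns the rules of
   calculus into algebra of limits. *)
Lemma nabla_caratheodory (h : R -> R) (t d : R) :
  deriv h t d <->
  exists2 q : R -> R, (forall s, h (r t) - h s = q s * (r t - s)) &
    q @ within I (nbhs t) --> d.
Proof.
split=> [H|[q hq /cvg_withinP qd] e e0].
  exists (fun s => if s == r t then d else (h (r t) - h s) / (r t - s)).
    move=> s; case: eqVneq => [->|srt]; first by rewrite !subrr mulr0.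
    by rewrite divfK// subr_eq0 eq_sym.
  apply/cvg_withinP => e e0; have /near_withinP[x x0 hx] := H e e0; exists x => //= s Is st.
  case: eqVneq => [_|srt]; first by rewrite subrr normr0 ltW.
  have nz : r t - s != 0 by rewrite subr_eq0 eq_sym.
  rewrite -(ler_pM2r (_ : 0 < `|r t - s|)) ?normr_gt0// -normrM mulrBl divfK//.
  exact: hx.
apply/near_withinP; have [x x0 hx] := qd e e0; exists x => // s Is st.
by rewrite hq -mulrBl normrM ler_wpM2r// hx.
Qed.

Lemma nabla_derivative_continuous (h : R -> R) (t d : R) :
  I t -> deriv h t d -> h @ within I (nbhs t) --> h t.
Proof.
move=> It /nabla_caratheodory[q hq qd].
have hE s : h s = h (r t) - q s * (r t - s) by rewrite -hq opprB addrC subrK.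
(* The filter is not punctured and [t] belongs to [I], so the limit of [q] must be its value at
   [t]. *)
have qt : q t = d.
  apply/eqP; rewrite -subr_eq0 -normr_le0; apply/ler_addgt0Pl => e e0.
  have /cvg_withinP/(_ e e0)[x x0 /(_ t It)] := qd.
  by rewrite subrr normr0 addr0; apply.
suff : (fun s => h (r t) - q s * (r t - s)) @ within I (nbhs t) --> h t.
  by apply: cvg_trans; apply: near_eq_cvg; apply/near_withinP; exists 1.
rewrite [h t]hE qt; apply: cvgB; first exact: cvg_cst.
apply: cvgM => //.
apply: cvgB; first exact: cvg_cst.
by apply/cvg_withinP => e e0; exists e => // s _ /ltW.
Qed.

Lemma nabla_derivative_eq (h k : R -> R) (t d : R) :
  I t -> (forall s, I s -> h s = k s) -> deriv h t d -> deriv k t d.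
Proof.
move=> It hk H e /H /near_withinP[x x0 hx]; apply/near_withinP; exists x => // s Is st.
by rewrite -!hk//; [exact: hx|exact: rho_ts_itv].
Qed.

Lemma nabla_derivativeD (h k : R -> R) (t d e : R) :
  deriv h t d -> deriv k t e -> deriv (fun s => h s + k s) t (d + e).
Proof.
move=> /nabla_caratheodory[p hp pd] /nabla_caratheodory[q hq qe].
apply/nabla_caratheodory; exists (fun s => p s + q s); last exact: cvgD.
by move=> s; rewrite mulrDl -hp -hq; ring.
Qed.

Lemma nabla_derivative_cst (c t : R) : deriv (fun=> c) t 0.
Proof.
apply/nabla_caratheodory; exists (fun=> 0); last exact: cvg_cst.
by move=> s; ring.
Qed.

Lemma nabla_derivative_id (t : R) : deriv id t 1.
Proof.
apply/nabla_caratheodory; exists (fun=> 1); last exact: cvg_cst.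
by move=> s; ring.
Qed.

Lemma nabla_derivativeM (h k : R -> R) (t d e : R) : I t ->
  deriv h t d -> deriv k t e ->
  deriv (fun s => h s * k s) t (d * k (r t) + h t * e).
Proof.
move=> It dh; have ch := nabla_derivative_continuous It dh.
move: dh => /nabla_caratheodory[p hp pd] /nabla_caratheodory[q hq qe].
apply/nabla_caratheodory; exists (fun s => p s * k (r t) + h s * q s).
  move=> s; rewrite mulrDl -mulrA (mulrC (k _)) mulrA -hp -(mulrA (h s)) -hq.
  ring.
by apply: cvgD; [apply: cvgM => //; exact: cvg_cst|exact: cvgM].
Qed.

Lemma nabla_derivativeZ (c : R) (h : R -> R) (t d : R) : I t ->
  deriv h t d -> deriv (fun s => c * h s) t (c * d).
Proof.
move=> It dh; have := nabla_derivativeM It (nabla_derivative_cst c t) dh.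
by rewrite mul0r add0r.
Qed.

(** Supplies a nonzero increment for the uniqueness of the derivative; at a left-scattered point [t]
    itself serves. This is where [kappa] matters: near a right-scattered [a] the only point is
    [a = rho a]. *)
Lemma near_neq_rho (t e : R) : K t -> 0 < e ->
  exists s, [/\ I s, `|s - t| < e & s != r t].
Proof.
move=> Kt e0; have It := kappa_ts_itv ts Kt.
have [ta|ta] := eqVneq t a.
  have /(kappaP ts)[_ /(_ ta e e0)[s [Is sa se]]] := Kt.
  exists s; split=> //; last by rewrite ta rho_a gt_eqF.
  by rewrite ta ger0_norm; lra.
have [[rt _ _]|[-> /(_ e e0)[s [Is es st]]]] := rhoP ts It ta.
  by exists t; rewrite subrr normr0 gt_eqF.
by exists s; rewrite lt_eqF//; split=> //; rewrite ler0_norm; lra.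
Qed.

Lemma nabla_derivative_unique (h : R -> R) (t d e : R) : K t ->
  deriv h t d -> deriv h t e -> d = e.
Proof.
move=> Kt dh eh; apply/eqP; rewrite -subr_eq0 -normr_le0; apply/ler_addgt0Pl => x x0.
have x20 : 0 < x / 2 by lra.
have /near_withinP[u u0 hu] := dh _ x20.
have /near_withinP[v v0 hv] := eh _ x20.
have uv0 : 0 < Num.min u v by rewrite lt_min u0.
have [s [Is]] := near_neq_rho Kt uv0; rewrite lt_min => /andP[su sv] sr.
have nz : 0 < `|r t - s| by rewrite normr_gt0 subr_eq0 eq_sym.
rewrite addr0 -(ler_pM2r nz) -normrM.
have := ler_normB (h (r t) - h s - e * (r t - s)) (h (r t) - h s - d * (r t - s)).
rewrite (_ : _ - _ - (_ - _) = (d - e) * (r t - s)); last by ring.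
by have := hu s Is su; have := hv s Is sv; lra.
Qed.

Lemma nablaE (h : R -> R) (t d : R) : K t -> deriv h t d -> nabla T a b h t = d.
Proof.
move=> Kt dh; apply: (nabla_derivative_unique Kt _ dh).
by apply: (@getPex _ [set d | deriv h t d]); exists d.
Qed.

(** Outside [K] there is at most a right-scattered [a], which is isolated in [I], so continuity is
    automatic there. *)
Lemma antiderivative_continuous (h H : R -> R) (t : R) :
  anti h H -> I t -> H @ within I (nbhs t) --> H t.
Proof.
move=> hH It; have [Kt|nKt] := pselect (K t).
  exact: nabla_derivative_continuous It (hH _ Kt).
apply/cvg_withinP => e e0; have ta := notin_kappa ts It nKt.
apply: contrapT => nd; apply: nKt; apply/(kappaP ts); split=> // _ x x0.
apply: contrapT => ns; apply: nd; exists x => // s Is.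
rewrite ta ltr_norml => /andP[_ sx]; have as_ := ts_itv_ge Is.
have [->|sa] := eqVneq s a; first by rewrite subrr normr0 ltW.
case: ns; exists s; split=> //; last by lra.
by rewrite lt_neqAle eq_sym sa.
Qed.

(* The set of points from which [H] stays above [H v] propagates to the left,
   because a nabla derivative controls the function on the left of a point. *)
Lemma nabla_decreasing (h H : R -> R) (u v : R) : anti h H ->
  I u -> I v -> u <= v -> (forall t, I t -> u < t -> t <= v -> h t < 0) ->
  H v <= H u.
Proof.
move=> hH Iu Iv uv h0.
pose S := [set t | [/\ I t, u <= t, t <= v &
                    forall s, I s -> t <= s -> s <= v -> H v <= H s]].
have S0 : S !=set0.
  exists v; split=> // s _ vs sv; suff -> : s = v by [].
  by apply/eqP; rewrite eq_le vs sv.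
have SI : S `<=` I by move=> t [].
have lbS : lbound S u by move=> t [].
have hi : has_inf S by split=> //; exists u.
set c := inf S; have Ic : I c by exact: inf_ts_itv.
have uc : u <= c by exact: lb_le_inf.
have c_le x : S x -> c <= x by move=> Sx; apply: ge_inf => //; exists u.
have cv : c <= v by have [x Sx] := S0; apply: le_trans (c_le _ Sx) _; case: Sx.
have Hc s : I s -> c < s -> s <= v -> H v <= H s.
  move=> Is cs sv; have sc0 : 0 < s - c by lra.
  have [x [Ix ux xv Hx]] := inf_adherent sc0 hi.
  by rewrite -/c addrC subrK => xs; apply: Hx => //; exact: ltW.
have Hvc : H v <= H c.
  apply/ler_addgt0Pl => e e0.
  have /cvg_withinP/(_ e e0)[d d0 hd] := antiderivative_continuous hH Ic.
  have [x Sx] := inf_adherent d0 hi; rewrite -/c => xd.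
  have cx := c_le _ Sx; have [Ix _ xv Hx] := Sx.
  have xc : `|x - c| < d by rewrite ger0_norm; lra.
  have := hd x Ix xc; rewrite ler_norml => /andP[_].
  by have := Hx x Ix (lexx _) xv; lra.
have Sc : S c.
  split=> // s Is; rewrite le_eqVlt => /predU1P[<-//|cs sv]; exact: Hc.
move: uc; rewrite le_eqVlt => /predU1P[->//|uc].
have Kc := gt_kappa ts Iu Ic uc.
have hc := h0 c Ic uc cv.
(* With the tolerance equal to [- h c], the error just cancels the linear term: [H] at [r c], or at
   nearby points to the left of a left-dense [c], is at least [H c]. So [S] reaches below its
   infimum. *)
have hc0 : 0 < - h c by lra.
have /near_withinP[d d0 hd] := hH c Kc _ hc0.
have ca : c != a by rewrite gt_eqF// (le_lt_trans _ uc)// (ts_itv_ge Iu).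
have [[rc Ir lr]|[rc hl]] := rhoP ts Ic ca.
- suff /c_le : S (r c) by rewrite leNgt rc.
  split=> //; [exact: lr|by apply: le_trans cv; exact: ltW|].
  move=> s Is rs sv; have [cs|sc] := leP c s.
    by move: cs; rewrite le_eqVlt => /predU1P[<-//|cs]; exact: Hc.
  have -> : s = r c by apply/eqP; rewrite eq_le rs lr.
  have := hd c Ic; rewrite subrr normr0 => /(_ d0).
  rewrite (ltr0_norm (_ : r c - c < 0)) ?subr_lt0// ler_norml => /andP[hl _].
  by apply: (le_trans Hvc); lra.
- have m0 : 0 < Num.min d (c - u) by rewrite lt_min d0; lra.
  have [x [Ix]] := hl _ m0; rewrite ltrBlDr -ltrBlDl lt_min => /andP[xd xu] xc.
  suff /c_le : S x by rewrite leNgt xc.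
  split=> //; [lra|lra|move=> s Is xs sv].
  have [cs|sc] := leP c s.
    by move: cs; rewrite le_eqVlt => /predU1P[<-//|cs]; exact: Hc.
  have scd : `|s - c| < d by rewrite ltr0_norm; lra.
  have := hd s Is scd.
  rewrite rc (gtr0_norm (_ : 0 < c - s)) ?subr_gt0// ler_norml => /andP[_ hu].
  by apply: (le_trans Hvc); lra.
Qed.

(** [nabla_decreasing] wants a strictly negative derivative, so a line of slope [M + e / (v - u)] is
    subtracted from [H]; the excess costs [e] over the interval, and [e] is arbitrary. *)
Lemma nabla_mean_value_le (h H : R -> R) (u v M : R) : anti h H ->
  I u -> I v -> u <= v -> (forall t, I t -> u < t -> t <= v -> h t <= M) ->
  H v - H u <= M * (v - u).
Proof.
move=> hH Iu Iv; rewrite le_eqVlt => /predU1P[-> _|uv hM]; first by rewrite !subrr mulr0.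
apply/ler_addgt0Pl => e e0; pose c := - (M + e / (v - u)).
have uv0 : 0 < v - u by rewrite subr_gt0.
have dH : anti (fun t => h t + c * 1) (fun t => H t + c * t).
  move=> t Kt; apply: nabla_derivativeD; first exact: hH.
  by apply: nabla_derivativeZ; [exact: kappa_ts_itv Kt|exact: nabla_derivative_id].
have := nabla_decreasing dH Iu Iv (ltW uv).
have q0 : 0 < e / (v - u) by rewrite divr_gt0.
have qE : e / (v - u) * (v - u) = e by rewrite divfK// gt_eqF.
suff H0 : forall t, I t -> u < t -> t <= v -> h t + c * 1 < 0.
  by move=> /(_ H0); rewrite /c; lra.
by move=> t It ut tv; have := hM t It ut tv; rewrite /c; lra.
Qed.

Lemma nabla_mean_value (h H : R -> R) (u v M : R) : anti h H ->
  I u -> I v -> u <= v -> (forall t, I t -> u < t -> t <= v -> `|h t| <= M) ->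
  `|H v - H u| <= M * (v - u).
Proof.
move=> hH Iu Iv uv hM.
have dN : anti (fun t => -1 * h t) (fun t => -1 * H t).
  by move=> t Kt; apply: nabla_derivativeZ; [exact: kappa_ts_itv Kt|exact: hH].
rewrite ler_norml; apply/andP; split.
  have := @nabla_mean_value_le _ _ u v M dN Iu Iv uv.
  suff H0 : forall t, I t -> u < t -> t <= v -> -1 * h t <= M by move=> /(_ H0); lra.
  by move=> t It ut /(hM t It ut); rewrite ler_norml => /andP[? ?]; lra.
apply: nabla_mean_value_le hH Iu Iv uv _.
by move=> t It ut /(hM t It ut); rewrite ler_norml => /andP[].
Qed.

End nabla_calculus.

(* A bounded form of ld-continuity: existence of right limits at left-scattered
   points is not required. *)
Definition ld_continuous (R : realType) (T : set R) (a b : R) (h : R -> R) : Prop :=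
  (exists B : R, forall t, kappa T a b t -> `|h t| <= B) /\
  (forall t, kappa T a b t -> rho T a b t = t ->
     h @ within (kappa T a b) (nbhs t) --> h t).

(** * Existence of antiderivatives and the nabla integral *)

Section antiderivatives.
Context {R : realType} {T : set R} {a b : R} (ts : ts_setting T a b).
Local Notation I := (ts_itv T a b).
Local Notation K := (kappa T a b).
Local Notation r := (rho T a b).
Local Notation anti := (nabla_antiderivative T a b).
Local Notation ld := (ld_continuous T a b).
Local Notation int := (nabla_integral T a b).
Local Notation integrable := (nabla_integrable T a b).

Lemma ld_continuous_cst (c : R) : ld (fun=> c).
Proof. by split=> [|t _ _]; [by exists (`|c|)|exact: cvg_cst]. Qed.

Lemma ld_continuousD (h k : R -> R) : ld h -> ld k -> ld (fun t => h t + k t).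
Proof.
move=> [[B hB] ch] [[C kC] ck]; split=> [|t Kt rt].
  exists (B + C) => t Kt; apply: le_trans (ler_normD _ _) _.
  by rewrite lerD ?hB ?kC.
by apply: cvgD; [exact: ch|exact: ck].
Qed.

Lemma ld_continuousM (h k : R -> R) : ld h -> ld k -> ld (fun t => h t * k t).
Proof.
move=> [[B hB] ch] [[C kC] ck]; split=> [|t Kt rt].
  by exists (B * C) => t Kt; rewrite normrM ler_pM ?hB ?kC.
by apply: cvgM; [exact: ch|exact: ck].
Qed.

Lemma eq_ld_continuous (h k : R -> R) : (forall t, K t -> h t = k t) -> ld h -> ld k.
Proof.
move=> hk [[B hB] ch]; split=> [|t Kt rt].
  by exists B => t Kt; rewrite -hk// hB.
rewrite -hk//; apply: cvg_trans (ch t Kt rt); apply: near_eq_cvg.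
by apply/near_withinP; exists 1 => // s Ks _; rewrite hk.
Qed.

(* The lower Darboux integral, described as the least function whose increments
   dominate every lower bound of the integrand times the length. *)
Lemma ld_continuous_darboux (h : R -> R) (B : R) : (forall t, K t -> `|h t| <= B) ->
  exists H : R -> R, forall u v m, I u -> I v -> u <= v ->
    ((forall t, I t -> u < t -> t <= v -> m <= h t) -> m * (v - u) <= H v - H u) /\
    ((forall t, I t -> u < t -> t <= v -> h t <= m) -> H v - H u <= m * (v - u)).
Proof.
move=> hB.
have hB' u v : I u -> I v -> u < v -> - B <= h v <= B.
  by move=> Iu Iv uv; rewrite -ler_norml hB//; exact: gt_kappa Iu Iv uv.
pose S := [set F : R -> R | F a = 0 /\ forall u v m, I u -> I v -> u <= v ->
  (forall t, I t -> u < t -> t <= v -> m <= h t) -> m * (v - u) <= F v - F u].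
(* The bound [B] dominates every lower bound of [h] on a nondegenerate interval, so [S] is nonempty
   and the infima below are meaningful. *)
have SB : S (fun t => B * (t - a)).
  split=> [|u v m Iu Iv]; first by rewrite subrr mulr0.
  rewrite le_eqVlt => /predU1P[->|uv] mh; first by rewrite !subrr mulr0.
  have := mh v Iv uv (lexx _); have /andP[_ hvB] := hB' _ _ Iu Iv uv => mv.
  rewrite -mulrBr (_ : v - a - (u - a) = v - u); last by ring.
  by rewrite ler_wpM2r ?subr_ge0 ?(ltW uv)// (le_trans mv).
pose H t := inf [set F t | F in S].
have hi t : I t -> has_inf [set F t | F in S].
  move=> It; split; first by exists (B * (t - a)), (fun t => B * (t - a)).
  exists (- B * (t - a)) => _ [F [Fa Fle] <-].
  rewrite -[F t]subr0 -Fa; apply: Fle => //; first exact: ts_itv_a.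
    exact: ts_itv_ge It.
  by move=> s Is /(hB' _ _ (ts_itv_a ts) Is)/andP[].
have H_le t F : I t -> S F -> H t <= F t.
  by move=> It SF; apply: ge_inf; [case: (hi t It)|exists F].
have SH : S H.
  have Hlow u v m : I u -> I v -> u <= v ->
      (forall t, I t -> u < t -> t <= v -> m <= h t) -> m * (v - u) <= H v - H u.
    move=> Iu Iv uv mh; rewrite lerBrDr; apply: lb_le_inf; first by case: (hi v Iv).
    move=> _ [F SF <-]; rewrite -lerBrDr; apply: le_trans (_ : F v - F u <= _).
      by case: SF => _; apply.
    by rewrite lerB// H_le.
  split=> //; apply/eqP; rewrite eq_le; apply/andP; split.
    by apply: le_trans (H_le _ _ (ts_itv_a ts) SB) _; rewrite subrr mulr0.
  by apply: lb_le_inf; [case: (hi _ (ts_itv_a ts))|move=> _ [F [-> _] <-]].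
have [_ Hle] := SH.
exists H => u v M Iu Iv uv; split; first exact: Hle.
move=> hM.
(* Competitor for the minimality of [H]: on the interval from [u] to [v] it is replaced by a line of
   slope [M], and beyond [v] it is translated, which keeps its increments. Once [F] is in [S],
   [H v <= F v] is the upper bound sought. *)
pose F t := if t <= u then H t else if t <= v then H u + M * (t - u)
            else H t - H v + H u + M * (v - u).
have mM m s t : I s -> I t -> s < t -> u < t -> t <= v ->
    (forall t', I t' -> s < t' -> t' <= t -> m <= h t') -> m <= M.
  by move=> Is It st ut tv mh; apply: le_trans (mh t It st (lexx _)) (hM t It ut tv).
suff /(H_le _ _ Iv) : S F.
  rewrite /F; case: (leP v u) => [vu _|_]; last by rewrite lexx lerBlDl.
  have -> : u = v by apply/eqP; rewrite eq_le uv vu.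
  by rewrite !subrr mulr0.
split; first by rewrite /F (ts_itv_ge Iu); case: SH.
move=> s t m Is It st mh; rewrite /F.
have [tu|ut] := leP t u.
  by rewrite (le_trans st tu); exact: Hle.
have [su|us] := leP s u.
  have h1 : m * (u - s) <= H u - H s.
    by apply: Hle => // x Ix sx xu; apply: mh => //; rewrite (le_trans xu)// ltW.
  have [tv|vt] := leP t v.
    have := mM m s t Is It (le_lt_trans su ut) ut tv mh => mM'.
    by have : m * (t - u) <= M * (t - u) by [rewrite ler_wpM2r// subr_ge0 ltW|]; lra.
  have h2 : m * (t - v) <= H t - H v.
    apply: Hle => //; first exact: ltW.
    by move=> x Ix vx xt; apply: mh => //; apply: le_lt_trans vx; apply: le_trans uv.
  have h3 : m * (v - u) <= M * (v - u).
    move: uv; rewrite le_eqVlt => /predU1P[->|uv]; first by rewrite !subrr !mulr0.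
    rewrite ler_wpM2r ?subr_ge0 ?(ltW uv)//.
    apply: (mM m s v) => //; first exact: le_lt_trans uv.
    by move=> x Ix sx xv; apply: mh => //; rewrite (le_trans xv)// ltW.
  by lra.
have [sv|vs] := leP s v; last first.
  rewrite (leNgt t v) (lt_le_trans vs st) /=.
  by have := Hle s t m Is It st mh; lra.
have [tv|vt] := leP t v.
  move: st; rewrite le_eqVlt => /predU1P[->|st]; first by rewrite !subrr mulr0.
  have := mM m s t Is It st ut tv mh => mM'.
  by have : m * (t - s) <= M * (t - s) by [rewrite ler_wpM2r// subr_ge0 ltW|]; lra.
have h2 : m * (t - v) <= H t - H v.
  apply: Hle => //; first exact: ltW.
  by move=> x Ix vx xt; apply: mh => //; apply: le_lt_trans vx.
have h3 : m * (v - s) <= M * (v - s).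
  move: sv; rewrite le_eqVlt => /predU1P[->|sv]; first by rewrite !subrr !mulr0.
  rewrite ler_wpM2r ?subr_ge0 ?(ltW sv)//.
  apply: (mM m s v) => //; first exact: lt_trans sv.
  by move=> x Ix sx xv; apply: mh => //; rewrite (le_trans xv)// ltW.
by lra.
Qed.

(** At a point with [r t = t], [h] stays within [e] of [h t] nearby and the Darboux bounds enclose
    the increments on both sides. At a left-scattered point [t] is the only point of [I] in the
    interval from [r t] (excluded) to [t], so the increment over it is exact whatever [h] does
    nearby, and the Lipschitz bound on [H] handles points close to [t]. *)
Lemma ld_continuous_integrable (h : R -> R) : ld h -> integrable h.
Proof.
move=> [[B hB] ch]; have [H HP] := ld_continuous_darboux hB.
have B0 : 0 <= B by apply: le_trans (hB b (kappa_b ts)).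
exists H => t Kt e e0; have It := kappa_ts_itv ts Kt.
have Ir := rho_ts_itv ts It.
have := rho_le ts It; rewrite le_eqVlt => /predU1P[rt|rt].
  have /cvg_withinP/(_ e e0)[d d0 hd] := ch t Kt rt.
  apply/near_withinP; exists d => // s Is st; rewrite rt.
  have [ts'|st'] := leP t s.
    have hs x : I x -> t < x -> x <= s -> h t - e <= h x <= h t + e.
      move=> Ix tx xs; rewrite -ler_distl; apply: hd; first exact: gt_kappa It Ix tx.
      move: st; rewrite !ltr_norml => /andP[? ?]; apply/andP; split; lra.
    have [h1 _] := HP t s (h t - e) It Is ts'.
    have [_ h2] := HP t s (h t + e) It Is ts'.
    have {}h1 := h1 (fun x Ix tx xs => proj1 (andP (hs x Ix tx xs))).
    have {}h2 := h2 (fun x Ix tx xs => proj2 (andP (hs x Ix tx xs))).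
    rewrite (ler0_norm (_ : t - s <= 0)) ?subr_le0// ler_norml.
    by apply/andP; split; lra.
  have hs x : I x -> s < x -> x <= t -> h t - e <= h x <= h t + e.
    move=> Ix sx xt; rewrite -ler_distl; apply: hd; first exact: gt_kappa Is Ix sx.
    move: st; rewrite !ltr_norml => /andP[? ?]; apply/andP; split; lra.
  have [h1 _] := HP s t (h t - e) Is It (ltW st').
  have [_ h2] := HP s t (h t + e) Is It (ltW st').
  have {}h1 := h1 (fun x Ix tx xs => proj1 (andP (hs x Ix tx xs))).
  have {}h2 := h2 (fun x Ix tx xs => proj2 (andP (hs x Ix tx xs))).
  rewrite (gtr0_norm (_ : 0 < t - s)) ?subr_gt0// ler_norml.
  by apply/andP; split; lra.
have Ht : H t - H (r t) = h t * (t - r t).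
  have hs x : I x -> r t < x -> x <= t -> x = t.
    move=> Ix rx; rewrite le_eqVlt => /predU1P[//|xt].
    by move: (le_rho ts Ix It xt); rewrite leNgt rx.
  have [h1 h2] := HP (r t) t (h t) Ir It (ltW rt).
  by apply/eqP; rewrite eq_le h1 ?h2// => x Ix rx xt; rewrite (hs x).
have lip s : I s -> `|H t - H s| <= B * `|t - s|.
  move=> Is; have hs u v : I u -> I v -> u <= v -> `|H v - H u| <= B * (v - u).
    move=> Iu Iv uv.
    have hx x : I x -> u < x -> x <= v -> - B <= h x <= B.
      by move=> Ix ux _; rewrite -ler_norml hB//; exact: gt_kappa Iu Ix ux.
    have [h1 _] := HP u v (- B) Iu Iv uv.
    have [_ h2] := HP u v B Iu Iv uv.
    have {}h1 := h1 (fun x Ix tx xs => proj1 (andP (hx x Ix tx xs))).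
    have {}h2 := h2 (fun x Ix tx xs => proj2 (andP (hx x Ix tx xs))).
    by rewrite ler_norml -mulNr h1.
  have [ts'|/ltW st'] := leP t s; last by rewrite [X in _ <= _ * X]ger0_norm ?subr_ge0// hs.
  by rewrite distrC (distrC t) [X in _ <= _ * X]ger0_norm ?subr_ge0// hs.
have g0 : 0 < t - r t by rewrite subr_gt0.
(* The first bound keeps [s] at least half the gap away from [r t]; the second makes the Lipschitz
   error [2 * B * |s - t|] at most [e] times half the gap. The [+ 1] covers [B = 0]. *)
pose d := Num.min ((t - r t) / 2) (e * (t - r t) / (4 * B + 1)).
have d0 : 0 < d.
  rewrite lt_min; apply/andP; split; first lra.
  by rewrite divr_gt0// ?mulr_gt0//; lra.
apply/near_withinP; exists d => // s Is.
rewrite lt_min => /andP[s1 s2].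
have B1 : 0 < 4 * B + 1 by lra.
move: s2; rewrite ltr_pdivlMr// => s2.
have le1 : `|H (r t) - H s - h t * (r t - s)| <= 2 * B * `|s - t|.
  rewrite (_ : H (r t) = H t - h t * (t - r t)); last by rewrite -Ht; ring.
  rewrite (_ : _ - _ - _ - _ = (H t - H s) - h t * (t - s)); last by ring.
  apply: le_trans (ler_normB _ _) _; rewrite normrM (distrC s).
  by have := lip s Is; have := ler_wpM2r (normr_ge0 (t - s)) (hB t Kt); lra.
apply: le_trans le1 _.
have le2 : (t - r t) / 2 <= `|r t - s|.
  move: s1; rewrite ltr_norml => /andP[? ?].
  by rewrite ler0_norm; lra.
have le3 : e * ((t - r t) / 2) <= e * `|r t - s| by rewrite ler_wpM2l// ltW.
by have := normr_ge0 (s - t); lra.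
Qed.

(** The difference of two antiderivatives has derivative zero, so the mean value inequality with
    [M := 0] makes its increment vanish and the choice made by [get] is harmless. *)
Lemma nabla_integralE (h H : R -> R) : anti h H -> int h = H b - H a.
Proof.
move=> hH; have [|H' [hH' intE]] := @getPex _ [set v : R |
  exists H : R -> R, anti h H /\ v = H b - H a]; first by exists (H b - H a), H.
have {intE}-> : int h = H' b - H' a := intE.
have dN : anti (fun t => h t + -1 * h t) (fun t => H t + -1 * H' t).
  move=> t Kt; apply: nabla_derivativeD; first exact: hH.
  by apply: nabla_derivativeZ; [exact: kappa_ts_itv Kt|exact: hH'].
have := nabla_mean_value ts dN (ts_itv_a ts) (ts_itv_b ts) (ltW (ts_lt ts)) (M := 0).
rewrite mul0r normr_le0 => H0.
suff : H b + -1 * H' b - (H a + -1 * H' a) == 0 by move/eqP; lra.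
by apply: H0 => t _ _ _; rewrite mulN1r subrr normr0.
Qed.

Lemma eq_antiderivative (h k H : R -> R) :
  (forall t, K t -> h t = k t) -> anti h H -> anti k H.
Proof. by move=> hk hH t Kt; rewrite -hk//; exact: hH. Qed.

Lemma eq_nabla_integral (h k : R -> R) :
  (forall t, K t -> h t = k t) -> integrable h -> int h = int k.
Proof.
move=> hk [H hH]; rewrite (nabla_integralE hH).
by rewrite (nabla_integralE (eq_antiderivative hk hH)).
Qed.

Lemma nabla_integrable_lin (c d : R) (h k : R -> R) : integrable h -> integrable k ->
  integrable (fun t => c * h t + d * k t).
Proof.
move=> [H hH] [L kL]; exists (fun t => c * H t + d * L t) => t Kt.
have It := kappa_ts_itv ts Kt.
by apply: nabla_derivativeD; apply: nabla_derivativeZ => //; [exact: hH|exact: kL].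
Qed.

Lemma nabla_integral_lin (c d : R) (h k : R -> R) : integrable h -> integrable k ->
  int (fun t => c * h t + d * k t) = c * int h + d * int k.
Proof.
move=> [H hH] [L kL]; rewrite (nabla_integralE hH) (nabla_integralE kL).
rewrite (@nabla_integralE _ (fun t => c * H t + d * L t)); first by ring.
move=> t Kt; have It := kappa_ts_itv ts Kt.
by apply: nabla_derivativeD; apply: nabla_derivativeZ => //; [exact: hH|exact: kL].
Qed.

Lemma nabla_integral_norm_le (h : R -> R) (M : R) : integrable h ->
  (forall t, K t -> `|h t| <= M) -> `|int h| <= M * (b - a).
Proof.
move=> [H hH] hM; rewrite (nabla_integralE hH).
apply: (nabla_mean_value ts hH (ts_itv_a ts) (ts_itv_b ts) (ltW (ts_lt ts))).
by move=> t It at_ _; apply: hM; exact: gt_kappa (ts_itv_a ts) It at_.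
Qed.

End antiderivatives.

(** * Functions of class C1 and the lemma of du Bois-Reymond *)

Section C1_functions.
Context {R : realType} {T : set R} {a b : R} (ts : ts_setting T a b).
Local Notation I := (ts_itv T a b).
Local Notation K := (kappa T a b).
Local Notation r := (rho T a b).
Local Notation anti := (nabla_antiderivative T a b).
Local Notation ld := (ld_continuous T a b).
Local Notation int := (nabla_integral T a b).
Local Notation C1 := (C1_nabla T a b).
Local Notation D := (nabla T a b).

Lemma continuous_ld_continuous (h : R -> R) : {within K, continuous h} -> ld h.
Proof.
move=> ch; split; last by move=> t Kt _; move/subspace_continuousP: ch; exact.
have /compact_bounded[M [Mreal hM]] := continuous_compact ch (compact_kappa ts).
exists (M + 1) => t Kt; apply: (hM (M + 1)); first by rewrite ltrDl.
by exists t.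
Qed.

Lemma antiderivative_bounded (h H : R -> R) : ld h -> anti h H ->
  exists B, forall t, I t -> `|H t| <= B.
Proof.
move=> [[B hB] _] hH; exists (`|H a| + B * (b - a)) => t It.
have B0 : 0 <= B by apply: le_trans (hB b (kappa_b ts)).
have at_ := ts_itv_ge It; have tb := ts_itv_le It.
have : `|H t - H a| <= B * (t - a).
  apply: (nabla_mean_value ts hH (ts_itv_a ts) It at_) => s Is as_ _.
  by apply: hB; exact: gt_kappa (ts_itv_a ts) Is as_.
have : B * (t - a) <= B * (b - a) by rewrite ler_wpM2l//; lra.
by have := ler_normD (H t - H a) (H a); rewrite subrK; lra.
Qed.

Lemma antiderivative_ld_continuous (h H : R -> R) : ld h -> anti h H -> ld H.
Proof.
move=> ldh hH; have [B HB] := antiderivative_bounded ldh hH.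
split=> [|t Kt _]; first by exists B => t /(kappa_ts_itv ts); exact: HB.
apply/cvg_withinP => e e0.
have /cvg_withinP/(_ e e0)[d d0 hd] :=
  antiderivative_continuous ts hH (kappa_ts_itv ts Kt).
by exists d => // s Ks; apply: hd; exact: kappa_ts_itv Ks.
Qed.

Lemma antiderivative_rho_ld_continuous (h H : R -> R) : ld h -> anti h H ->
  ld (fun t => H (r t)).
Proof.
move=> ldh hH; have [B HB] := antiderivative_bounded ldh hH.
split=> [|t Kt rt].
  by exists B => t /(kappa_ts_itv ts)/(rho_ts_itv ts); exact: HB.
apply/cvg_withinP => e e0.
have /cvg_withinP/(_ e e0)[d d0 hd] :=
  antiderivative_continuous ts hH (kappa_ts_itv ts Kt).
have [d' d'0 hd'] := rho_near ts Kt rt d0.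
exists d' => // s /(kappa_ts_itv ts) Is sd; rewrite rt.
by apply: hd; [exact: rho_ts_itv|exact: hd'].
Qed.

Lemma C1_antiderivative (w : R -> R) : C1 w -> anti (D w) w.
Proof. by move=> [dw _] t /dw; exact: getPex. Qed.

Lemma C1_nabla_ld_continuous (w : R -> R) : C1 w -> ld (D w).
Proof. by move=> [_ cw]; exact: continuous_ld_continuous. Qed.

Lemma C1_rho_ld_continuous (w : R -> R) : C1 w -> ld (fun t => w (r t)).
Proof.
move=> C1w.
exact: antiderivative_rho_ld_continuous (C1_nabla_ld_continuous C1w) (C1_antiderivative C1w).
Qed.

Lemma antiderivative_C1 (h H : R -> R) : {within K, continuous h} -> anti h H -> C1 H.
Proof.
move=> ch hH; split=> [t Kt|]; first by exists (h t); exact: hH.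
apply: subspace_eq_continuous ch => t; rewrite inE => Kt.
by apply/esym/(nablaE ts Kt)/hH.
Qed.

Lemma C1_lin (c d : R) (w z : R -> R) : C1 w -> C1 z ->
  C1 (fun t => c * w t + d * z t) /\
  forall t, K t -> D (fun t => c * w t + d * z t) t = c * D w t + d * D z t.
Proof.
move=> C1w C1z; have dwz : anti (fun t => c * D w t + d * D z t) (fun t => c * w t + d * z t).
  move=> t Kt; have It := kappa_ts_itv ts Kt.
  by apply: nabla_derivativeD; apply: nabla_derivativeZ => //;
    exact: C1_antiderivative.
split=> [|t Kt]; last exact: nablaE Kt (dwz t Kt).
apply: antiderivative_C1 dwz; case: C1w => _ /subspace_continuousP cw.
case: C1z => _ /subspace_continuousP cz; apply/subspace_continuousP => t Kt.
by apply: cvgD; apply: cvgM; [exact: cvg_cst|exact: cw|exact: cvg_cst|exact: cz].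
Qed.

(** The integral of [phi * w] agrees with that of [phi] over times after [s], except on the ramp of
    length [h], where either integrand is bounded by [B]. *)
Lemma ramp_integral (phi Phi w P : R -> R) (B s h : R) : 0 < h -> I s ->
  anti phi Phi -> anti (fun t => phi t * w t) P ->
  (forall t, K t -> `|phi t| <= B) -> (forall t, `|w t| <= 1) ->
  (forall t, t <= s -> w t = 0) -> (forall t, s + h <= t -> w t = 1) ->
  `|P b - P a - (Phi b - Phi s)| <= 2 * B * h.
Proof.
move=> h0 Is dPhi dP phiB w1 ws0 ws1.
have B0 : 0 <= B by apply: le_trans (phiB b (kappa_b ts)).
(* The end [s + h] of the ramp need not be in the time scale. Its substitute [v] is the last point
   of [I] up to [s + h]; after [v] the weight is already [1]. *)
pose A := [set t | I t /\ t <= s + h].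
have As : A s by split=> //; rewrite lerDl ltW.
have hA : has_sup A by split; [exists s|exists (s + h) => t []].
have A0 : A !=set0 by exists s.
set v := sup A; have Iv : I v by apply: sup_ts_itv A0 => // t [].
have sv : s <= v by exact: sup_upper_bound.
have vsh : v <= s + h by apply: ge_sup => // t [].
have gtv t : I t -> v < t -> s + h < t.
  move=> It vt; rewrite ltNge; apply/negP => ts'.
  by move: vt; rewrite ltNge => /negP; apply; apply: sup_upper_bound.
have P1 : `|P s - P a| <= 0 * (s - a).
  apply: (nabla_mean_value ts dP (ts_itv_a ts) Is (ts_itv_ge Is)) => t It _ /ws0 ->.
  by rewrite mulr0 normr0.
have dN : anti (fun t => phi t * w t + -1 * phi t) (fun t => P t + -1 * Phi t).
  move=> t Kt; apply: nabla_derivativeD; first exact: dP.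
  by apply: nabla_derivativeZ; [exact: kappa_ts_itv Kt|exact: dPhi].
have P2 : `|P b + -1 * Phi b - (P v + -1 * Phi v)| <= 0 * (b - v).
  apply: (nabla_mean_value ts dN Iv (ts_itv_b ts) (ts_itv_le Iv)) => t It vt _.
  by rewrite ws1 ?mulr1 ?mulN1r ?subrr ?normr0// ltW// gtv.
have P3 : `|P v - P s| <= B * (v - s).
  apply: (nabla_mean_value ts dP Is Iv sv) => t It st _.
  by rewrite normrM -[B]mulr1 ler_pM// phiB//; exact: gt_kappa Is It st.
have P4 : `|Phi v - Phi s| <= B * (v - s).
  apply: (nabla_mean_value ts dPhi Is Iv sv) => t It st _.
  by apply: phiB; exact: gt_kappa Is It st.
have P5 : B * (v - s) <= B * h by rewrite ler_wpM2l//; lra.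
move: P1 P2 P3 P4; rewrite !mul0r !normr_le0 !ler_norml.
by move=> /eqP ? /eqP ? /andP[? ?] /andP[? ?]; apply/andP; split; lra.
Qed.

(* Weights [w] continuous on kappa are exactly the derivatives available here;
   [phi] itself need not be one, so ramps approximate the indicator of
   [(s, b]] instead. *)
Lemma dubois_reymond (phi : R -> R) : ld phi ->
  (forall eta, C1 eta -> eta a = 0 -> eta b = 0 ->
     int (fun t => phi t * D eta t) = 0) ->
  exists c, forall t, K t -> phi t = c.
Proof.
move=> ldphi H; have [Phi dPhi] := ld_continuous_integrable ts ldphi.
have ab0 : 0 < b - a by rewrite subr_gt0; exact: ts_lt ts.
pose c := (Phi b - Phi a) / (b - a); exists c.
have cE : c * (b - a) = Phi b - Phi a by rewrite divfK// gt_eqF.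
have did : anti (fun=> 1) id by move=> t _; exact: nabla_derivative_id.
have orth w P W : {within K, continuous w} -> anti (fun t => phi t * w t) P ->
    anti w W -> P b - P a = c * (W b - W a).
  move=> cw dP dW; pose m := (W b - W a) / (b - a).
  have mE : m * (b - a) = W b - W a by rewrite divfK// gt_eqF.
  (* Subtracting from [w] its mean [m] yields the derivative of a test function vanishing at both
     ends; hence every weight pairs with [phi] as it pairs with the constant [c], the mean of
     [phi]. *)
  pose eta t := W t + (- m * t + (m * a - W a)).
  have deta : anti (fun t => w t + (- m * 1 + 0)) eta.
    move=> t Kt; have It := kappa_ts_itv ts Kt.
    apply: nabla_derivativeD; first exact: dW.
    apply: nabla_derivativeD; last exact: nabla_derivative_cst.
    by apply: nabla_derivativeZ => //; exact: did.
  have C1eta : C1 eta.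
    apply: antiderivative_C1 deta; apply/subspace_continuousP => t Kt.
    by apply: cvgD; [by move/subspace_continuousP : cw; exact|exact: cvg_cst].
  have dE : anti (fun t => phi t * D eta t) (fun t => P t + - m * Phi t).
    apply: (@eq_antiderivative _ _ _ _ (fun t => phi t * w t + - m * phi t)).
      by move=> t Kt; rewrite (nablaE ts Kt (deta t Kt)); ring.
    move=> t Kt; apply: nabla_derivativeD; first exact: dP.
    by apply: nabla_derivativeZ; [exact: kappa_ts_itv Kt|exact: dPhi].
  have := H eta C1eta; rewrite (nabla_integralE ts dE) /eta.
  move=> /(_ ltac:(lra) ltac:(lra)) E.
  have : P b - P a = m * (Phi b - Phi a) by lra.
  by rewrite -cE -mE => ->; ring.
have Phi_s s : I s -> Phi b - Phi s = c * (b - s).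
  move=> Is; apply/eqP; rewrite -subr_eq0 -normr_le0; apply/ler_addgt0Pl => e e0.
  have [[B phiB] _] := ldphi.
  have B0 : 0 <= B by apply: le_trans (phiB b (kappa_b ts)).
  (* The two uses of the ramp estimate cost [2 * B * h] for [phi] and [2 * |c| * h] for the constant
     [1] scaled by [c]; the final [+ 1] keeps the denominator positive. *)
  pose h := e / (2 * B + 2 * `|c| + 1).
  have den0 : 0 < 2 * B + 2 * `|c| + 1 by have := normr_ge0 c; lra.
  have h0 : 0 < h by rewrite divr_gt0.
  have hE : h * (2 * B + 2 * `|c| + 1) = e by rewrite divfK// gt_eqF.
  pose x t := h^-1 * (t - s).
  have hx t : h * x t = t - s by rewrite /x mulrA mulfV ?mul1r// gt_eqF.
  (* This is [x t] clamped between 0 and 1, written with absolute values so that its continuity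
     follows from that of the norm. *)
  pose w t := 2^-1 * (1 + `|x t| - `|x t - 1|).
  have cw : {within K, continuous w}.
    apply/subspace_continuousP => t Kt.
    have cx : x @ within K (nbhs t) --> x t.
      apply: cvgM; first exact: cvg_cst.
      apply: cvgB; last exact: cvg_cst.
      by apply/cvg_withinP => e' e'0; exists e' => // ? _ /ltW.
    apply: cvgM; first exact: cvg_cst.
    apply: cvgB; first by apply: cvgD; [exact: cvg_cst|exact: cvg_norm].
    by apply: cvg_norm; apply: cvgB => //; exact: cvg_cst.
  have w1 t : `|w t| <= 1.
    rewrite /w ler_norml; have := ler_distD 0 (x t) 1; have := ler_distD (x t) 1 0.
    rewrite !subr0 !sub0r normrN normr1 (distrC 1) => ? ?.
    have := ler_dist_dist (x t) 1; rewrite normr1 ler_norml => /andP[? ?].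
    by apply/andP; split; lra.
  have ws0 t : t <= s -> w t = 0.
    move=> ts'; have x0 : x t <= 0 by rewrite -(pmulr_rle0 _ h0) hx subr_le0.
    by rewrite /w !ler0_norm; lra.
  have ws1 t : s + h <= t -> w t = 1.
    move=> ts'; have x0 : 1 <= x t by rewrite -(ler_pM2l h0) hx mulr1; lra.
    by rewrite /w !ger0_norm; lra.
  have ldw := continuous_ld_continuous cw.
  have [W dW] := ld_continuous_integrable ts ldw.
  have [P dP] := ld_continuous_integrable ts (ld_continuousM ldphi ldw).
  have E1 := ramp_integral h0 Is dPhi dP phiB w1 ws0 ws1.
  have dW1 : anti (fun t => 1 * w t) W.
    by apply: eq_antiderivative dW => t _; rewrite mul1r.
  have one t : K t -> `|1 : R| <= 1 by rewrite normr1.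
  (* The same estimate with integrand [1] compares the integral of [w] with [b - s]. *)
  have E2 := ramp_integral h0 Is did dW1 one w1 ws0 ws1.
  rewrite (orth w P W cw dP dW) in E1.
  have E3 : `|c * (W b - W a - (b - s))| <= `|c| * (2 * 1 * h).
    by rewrite normrM ler_wpM2l.
  have := ler_normB (c * (W b - W a - (b - s))) (c * (W b - W a) - (Phi b - Phi s)).
  rewrite (_ : c * (W b - W a - (b - s)) - (c * (W b - W a) - (Phi b - Phi s)) =
    Phi b - Phi s - c * (b - s)); last by ring.
  by lra.
move=> t Kt; apply: (nabla_derivative_unique ts Kt (dPhi t Kt)).
have It := kappa_ts_itv ts Kt.
apply: (@nabla_derivative_eq _ _ _ _ ts (fun s => c * s + (Phi b - c * b))) => //.
  by move=> s Is; have := Phi_s s Is; lra.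
rewrite -[c in is_nabla_derivative _ _ _ _ _ c]addr0 -[X in X + 0]mulr1.
apply: nabla_derivativeD; last exact: nabla_derivative_cst.
by apply: nabla_derivativeZ => //; exact: did.
Qed.

End C1_functions.

(** * Mean value estimates in one and two real variables *)

Section mean_value_estimates.
Context {R : realType}.

Lemma mean_value_norm_le (g dg : R -> R) (x x' C : R) :
  (forall z : R, is_derive z 1 g (dg z)) ->
  (forall z, `|z - x| <= `|x' - x| -> `|dg z| <= C) ->
  `|g x' - g x| <= C * `|x' - x|.
Proof.
move=> dgP gC.
have cg u v : {within `[u, v], continuous g}.
  apply: continuous_subspaceT => z; apply: differentiable_continuous.
  by apply/derivable1_diffP; have [] := dgP z.
have [xx'|/ltW x'x] := leP x x'.
  have [c cxx' ->] := MVT_segment xx' (fun z _ => dgP z) (cg x x').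
  rewrite normrM ler_wpM2r//; apply: gC; move: cxx'; rewrite in_itv /= => /andP[? ?].
  by rewrite !ger0_norm ?subr_ge0// lerD2r.
have [c cxx' E] := MVT_segment x'x (fun z _ => dgP z) (cg x' x).
rewrite distrC E normrM (distrC x') ler_wpM2r//; apply: gC.
move: cxx'; rewrite in_itv /= => /andP[? ?].
by rewrite !ler0_norm ?subr_le0// lerN2 lerD2r.
Qed.

Lemma mean_value2_norm_le (psi px pv : R -> R -> R) (x v x' v' C : R) :
  (forall z w : R, is_derive z 1 (psi ^~ w) (px z w)) ->
  (forall z w : R, is_derive w 1 (psi z) (pv z w)) ->
  (forall z w, `|z - x| <= `|x' - x| -> `|w - v| <= `|v' - v| ->
     `|px z w| <= C /\ `|pv z w| <= C) ->
  `|psi x' v' - psi x v| <= C * (`|x' - x| + `|v' - v|).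
Proof.
move=> dx dv hC.
have h1 : `|psi x' v' - psi x v'| <= C * `|x' - x|.
  apply: (@mean_value_norm_le (psi ^~ v') (px ^~ v')) => // z zx.
  by case: (hC z v' zx (lexx _)).
have h2 : `|psi x v' - psi x v| <= C * `|v' - v|.
  apply: (@mean_value_norm_le (psi x) (pv x)) => // w wv.
  by case: (hC x w _ wv) => //; rewrite subrr normr0.
have := ler_distD (psi x v') (psi x' v') (psi x v).
by rewrite mulrDr; lra.
Qed.

End mean_value_estimates.

(** * Bounds and uniform continuity on compact boxes *)

Definition jointly_continuous (R : realType) (T : set R) (a b : R)
    (F : R -> R -> R -> R) : Prop :=
  {within [set p : R * R * R | ts_itv T a b p.1.1],
    continuous (fun p : R * R * R => F p.1.1 p.1.2 p.2)}.

Section lagrangian_estimates.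
Context {R : realType} {T : set R} {a b : R} (ts : ts_setting T a b).
Local Notation I := (ts_itv T a b).
Local Notation K := (kappa T a b).
Local Notation ld := (ld_continuous T a b).

Definition box (M : R) : set (R * R * R) := I `*` `[- M, M] `*` `[- M, M].

Lemma compact_box M : compact (box M).
Proof.
by apply: compact_setX; [apply: compact_setX; [exact: compact_ts_itv|]|];
  exact: segment_compact.
Qed.

Lemma boxP M t x v : I t -> `|x| <= M -> `|v| <= M -> box M (t, x, v).
Proof. by move=> It xM vM; split; [split=> //|]; rewrite /= in_itv /= -ler_norml. Qed.

Lemma jointly_continuous_bounded (F : R -> R -> R -> R) (M : R) :
  jointly_continuous T a b F ->
  exists B, forall t x v, I t -> `|x| <= M -> `|v| <= M -> `|F t x v| <= B.
Proof.
move=> cF; have sub : box M `<=` [set p : R * R * R | I p.1.1] by move=> p [[]].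
have [B [_ hB]] := compact_bounded
  (continuous_compact (continuous_subspaceW sub cF) (@compact_box M)).
exists (B + 1) => t x v It xM vM; apply: (hB (B + 1)); first by rewrite ltrDl.
by exists (t, x, v) => //; exact: boxP.
Qed.

(** Only [(t, x, v)] is confined to the box; [(s, x', v')] may leave it, as perturbed arguments do.
    Hence a covering argument in place of uniform continuity on the box: half of a radius of
    continuity at [p] serves all points of the half ball around [p]. *)
Lemma jointly_continuous_unif (F : R -> R -> R -> R) (M e : R) :
  jointly_continuous T a b F -> 0 < e ->
  exists2 d, 0 < d & forall t x v s x' v', I t -> I s -> `|x| <= M -> `|v| <= M ->
    `|s - t| < d -> `|x' - x| < d -> `|v' - v| < d ->
    `|F s x' v' - F t x v| <= e.
Proof.
move=> /subspace_continuousP cF e0.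
pose P (d : R) (p : R * R * R) := I p.1.1 -> forall s x' v', I s ->
  `|s - p.1.1| < d -> `|x' - p.1.2| < d -> `|v' - p.2| < d ->
  `|F s x' v' - F p.1.1 p.1.2 p.2| <= e.
have e20 : 0 < e / 2 by lra.
have Pnear : \forall d \near 0^'+, box M `<=` P d.
  apply: (iffLR (compact_near_coveringP _) (@compact_box M)).
  move=> p boxp; have Ip : I p.1.1 by case: boxp => [[]].
  have /cvgrPdist_le/(_ _ e20) := cF p Ip.
  rewrite near_withinE => /nbhs_ballP[d /= d0 hd].
  have d20 : 0 < d / 2 by lra.
  exists (ball p (d / 2), [set x | x < d / 2]).
    by split => /=; [exact: nbhsx_ballx|exact: nbhs_right_lt].
  move=> [q x] /= [[[q1 q2] q3] xd] Iq s x' v' Is s1 s2 s3.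
  have h1 : `|F p.1.1 p.1.2 p.2 - F q.1.1 q.1.2 q.2| <= e / 2.
    apply: (hd q) => //; apply: le_ball (_ : ball p (d / 2) q); first lra.
    by split=> //; split.
  have h2 : `|F p.1.1 p.1.2 p.2 - F s x' v'| <= e / 2.
    apply: (hd (s, x', v')) => //; split; first split => /=.
    - move: q1; rewrite /ball /= => q1; have := ler_distD q.1.1 p.1.1 s.
      by rewrite (distrC q.1.1 s); lra.
    - move: q2; rewrite /ball /= => q2; have := ler_distD q.1.2 p.1.2 x'.
      by rewrite (distrC q.1.2 x'); lra.
    - move: q3; rewrite /ball /= => q3; have := ler_distD q.2 p.2 v'.
      by rewrite (distrC q.2 v'); lra.
  have := ler_distD (F p.1.1 p.1.2 p.2) (F s x' v') (F q.1.1 q.1.2 q.2).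
  by rewrite (distrC (F s x' v') (F p.1.1 p.1.2 p.2)); lra.
have Q : \forall d \near 0^'+, box M `<=` P d /\ 0 < d.
  by apply: filterI Pnear _; exact: nbhs_right_gt.
have [d [hd d0]] := @filter_ex _ _ (at_right_proper_filter _) _ Q.
exists d => // t x v s x' v' It Is xM vM.
by apply: (hd (t, x, v)) => //; exact: boxP.
Qed.


Lemma ld_continuous_comp (F : R -> R -> R -> R) (X V : R -> R) :
  jointly_continuous T a b F -> ld X -> ld V -> ld (fun t => F t (X t) (V t)).
Proof.
move=> cF [[A hA] cX] [[B hB] cV]; pose M := Num.max A B.
have XM t : K t -> `|X t| <= M by move=> Kt; rewrite le_max hA.
have VM t : K t -> `|V t| <= M by move=> Kt; rewrite le_max hB ?orbT.
have KI := @kappa_ts_itv _ _ _ _ ts.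
split=> [|t Kt rt].
  have [C hC] := jointly_continuous_bounded M cF.
  by exists C => t Kt; apply: hC; [exact: KI|exact: XM|exact: VM].
apply/cvg_withinP => e e0; have [d d0 hd] := jointly_continuous_unif M cF e0.
have d20 : 0 < d / 2 by lra.
have /cvg_withinP/(_ _ d20)[u u0 hu] := cX t Kt rt.
have /cvg_withinP/(_ _ d20)[v v0 hv] := cV t Kt rt.
exists (Num.min d (Num.min u v)); first by rewrite !lt_min d0 u0.
move=> s Ks; rewrite !lt_min => /and3P[sd su sv].
apply: hd => //; [exact: KI|exact: KI|exact: XM|exact: VM| |].
  by apply: le_lt_trans (hu s Ks su) _; lra.
by apply: le_lt_trans (hv s Ks sv) _; lra.
Qed.

End lagrangian_estimates.

(** * Increments of a Lagrangian in its second and third variables *)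

Section lagrangian_increments.
Context {R : realType} {T : set R} {a b : R} (ts : ts_setting T a b).
Local Notation I := (ts_itv T a b).
Local Notation K := (kappa T a b).
Local Notation ld := (ld_continuous T a b).
Context {f : R -> R -> R -> R} (hf : continuous_partials T a b f).

Lemma partial_x_jointly_continuous : jointly_continuous T a b (partial_x f).
Proof. exact: (proj1 (proj2 hf)). Qed.

Lemma partial_v_jointly_continuous : jointly_continuous T a b (partial_v f).
Proof. exact: (proj2 (proj2 hf)). Qed.

Lemma is_derive_partial_x (t x v : R) : I t ->
  is_derive x 1 (fun z => f t z v) (partial_x f t x v).
Proof.
by move=> It; have [/(_ t x v It)[dx _] _] := hf; rewrite /partial_x derive1E; split.
Qed.

Lemma is_derive_partial_v (t x v : R) : I t ->
  is_derive v 1 (f t x) (partial_v f t x v).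
Proof.
by move=> It; have [/(_ t x v It)[_ dv] _] := hf; rewrite /partial_v derive1E; split.
Qed.

(** The mean value estimates ask for bounds on the whole ball of radius [|x' - x|] around [x], which
    may reach [3 * M]. *)
Let near_box (M x x' z : R) : `|x| <= M -> `|x'| <= M -> `|z - x| <= `|x' - x| ->
  `|z| <= 3 * M.
Proof.
move=> xM x'M zx; have := ler_normD (z - x) x; rewrite subrK.
by have := ler_normB x' x; lra.
Qed.

Lemma lagrangian_lipschitz (M : R) : exists2 B, 0 <= B &
  forall t x v x' v', I t -> `|x| <= M -> `|v| <= M -> `|x'| <= M -> `|v'| <= M ->
    `|f t x' v' - f t x v| <= B * (`|x' - x| + `|v' - v|).
Proof.
have [B hB] := jointly_continuous_bounded ts (3 * M) partial_x_jointly_continuous.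
have [C hC] := jointly_continuous_bounded ts (3 * M) partial_v_jointly_continuous.
exists (Num.max 0 (Num.max B C)); first by rewrite le_max lexx.
move=> t x v x' v' It xM vM x'M v'M.
apply: (@mean_value2_norm_le _ (f t) (partial_x f t) (partial_v f t)).
- by move=> z w; exact: is_derive_partial_x.
- by move=> z w; exact: is_derive_partial_v.
- move=> z w zx wv; have z3 := near_box xM x'M zx; have w3 := near_box vM v'M wv.
  split; [apply: le_trans (hB _ _ _ It z3 w3) _|apply: le_trans (hC _ _ _ It z3 w3) _].
    by rewrite !le_max lexx orbT.
  by rewrite !le_max lexx !orbT.
Qed.

(** The mean value estimate is applied to [f t] minus its linear part at [(x, v)]: the partial
    derivatives of the difference are oscillations of [partial_x f] and [partial_v f], small
    uniformly on the box. *)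
Lemma lagrangian_taylor (M e : R) : 0 < e -> exists2 d, 0 < d &
  forall t x v p q, I t -> `|x| <= M -> `|v| <= M -> `|p| < d -> `|q| < d ->
    `|f t (x + p) (v + q) - f t x v - (partial_x f t x v * p + partial_v f t x v * q)|
      <= e * (`|p| + `|q|).
Proof.
move=> e0.
have [d d0 hd] := jointly_continuous_unif ts M partial_x_jointly_continuous e0.
have [d' d'0 hd'] := jointly_continuous_unif ts M partial_v_jointly_continuous e0.
exists (Num.min d d'); first by rewrite lt_min d0.
move=> t x v p q It xM vM; rewrite !lt_min => /andP[pd pd'] /andP[qd qd'].
pose A := partial_x f t x v; pose B := partial_v f t x v.
pose psi z w := f t z w - A * z - B * w.
have lin (c z : R) : is_derive z 1 (fun u => c * u) c.
  have := @is_deriveZ R R^o R^o id c z 1 1 (is_derive_id _ _).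
  by rewrite /GRing.scale /= mulr1.
(* Each [0] is the derivative of the linear term in the other variable, kept so that the derivatives
   have the shape that [is_deriveB] produces. *)
have := @mean_value2_norm_le _ psi (fun z w => partial_x f t z w - A - 0)
  (fun z w => partial_v f t z w - 0 - B) x v (x + p) (v + q) e.
rewrite /psi (addrC x) (addrC v) !addrK.
rewrite (_ : _ - _ - _ - _ = f t (p + x) (q + v) - f t x v - (A * p + B * q)); last by ring.
apply.
- move=> z w; have dx := is_derive_partial_x z w It.
  exact: is_deriveB (is_deriveB dx (lin A z)) (is_derive_cst (B * w) z 1).
- move=> z w; have dv := is_derive_partial_v z w It.
  exact: is_deriveB (is_deriveB dv (is_derive_cst (A * z) w 1)) (lin B w).
- move=> z w zx wv; rewrite !subr0; split.
    by apply: hd; rewrite ?subrr ?normr0//; [exact: le_lt_trans pd|exact: le_lt_trans qd].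
  by apply: hd'; rewrite ?subrr ?normr0//; [exact: le_lt_trans pd'|exact: le_lt_trans qd'].
Qed.

(* [f] need not be continuous in time, but its increments in the other two
   variables are. *)
Lemma lagrangian_increment_unif (M e : R) : 0 < e -> exists2 d, 0 < d &
  forall t s x v x' v', I t -> I s -> `|s - t| < d ->
    `|x| <= M -> `|v| <= M -> `|x'| <= M -> `|v'| <= M ->
    `|f s x' v' - f s x v - (f t x' v' - f t x v)| <= e * (`|x' - x| + `|v' - v|).
Proof.
move=> e0.
have [d d0 hd] := jointly_continuous_unif ts (3 * M) partial_x_jointly_continuous e0.
have [d' d'0 hd'] := jointly_continuous_unif ts (3 * M) partial_v_jointly_continuous e0.
exists (Num.min d d'); first by rewrite lt_min d0.
move=> t s x v x' v' It Is; rewrite lt_min => /andP[sd sd'] xM vM x'M v'M.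
have := @mean_value2_norm_le _ (fun z w => f s z w - f t z w)
  (fun z w => partial_x f s z w - partial_x f t z w)
  (fun z w => partial_v f s z w - partial_v f t z w) x v x' v' e.
rewrite (_ : _ - _ - _ = f s x' v' - f s x v - (f t x' v' - f t x v)); last by ring.
apply.
- move=> z w; have ? := is_derive_partial_x z w It; have ? := is_derive_partial_x z w Is.
  exact: is_deriveB.
- move=> z w; have ? := is_derive_partial_v z w It; have ? := is_derive_partial_v z w Is.
  exact: is_deriveB.
- move=> z w zx wv; have z3 := near_box xM x'M zx; have w3 := near_box vM v'M wv.
  by split; [apply: hd|apply: hd']; rewrite ?subrr ?normr0.
Qed.

(** To pass from time [s] to a left-dense [t], the arguments are moved first at fixed time [s], at a
    Lipschitz cost; then only the time changes, and [lagrangian_increment_unif] applies. *)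
Lemma lagrangian_increment_ld_continuous (X V X' V' : R -> R) :
  ld X -> ld V -> ld X' -> ld V' ->
  ld (fun t => f t (X' t) (V' t) - f t (X t) (V t)).
Proof.
move=> [[A1 h1] c1] [[A2 h2] c2] [[A3 h3] c3] [[A4 h4] c4].
pose M := Num.max (Num.max A1 A2) (Num.max A3 A4).
have m1 t : K t -> `|X t| <= M by move=> Kt; rewrite !le_max h1.
have m2 t : K t -> `|V t| <= M by move=> Kt; rewrite !le_max h2 ?orbT.
have m3 t : K t -> `|X' t| <= M by move=> Kt; rewrite !le_max h3 ?orbT.
have m4 t : K t -> `|V' t| <= M by move=> Kt; rewrite !le_max h4 ?orbT.
have KI := @kappa_ts_itv _ _ _ _ ts.
have [B B0 hB] := lagrangian_lipschitz M.
have M0 : 0 <= M by apply: le_trans (m1 b (kappa_b ts)).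
split=> [|t Kt rt].
  exists (B * (4 * M)) => t Kt; apply: le_trans (hB _ _ _ _ _ _ _ _ _ _) _; auto.
  rewrite ler_wpM2l//; have := ler_normB (X' t) (X t); have := ler_normB (V' t) (V t).
  by have := m1 t Kt; have := m2 t Kt; have := m3 t Kt; have := m4 t Kt; lra.
apply/cvg_withinP => e e0.
(* Half of [e] pays for the change of time, over increments of total size at most [4 * M]; [e2]
   reserves the other half for the two Lipschitz errors of [B * (2 * e2)]. *)
pose e1 := e / (2 * (4 * M + 1)); have e10 : 0 < e1 by rewrite divr_gt0//; lra.
have e1E : e1 * (2 * (4 * M + 1)) = e by rewrite divfK// gt_eqF//; lra.
pose e2 := e / (2 * (4 * B + 1)); have e20 : 0 < e2 by rewrite divr_gt0//; lra.
have e2E : e2 * (2 * (4 * B + 1)) = e by rewrite divfK// gt_eqF//; lra.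
have [d d0 hd] := lagrangian_increment_unif M e10.
have /cvg_withinP/(_ _ e20)[d1 d10 hd1] := c1 t Kt rt.
have /cvg_withinP/(_ _ e20)[d2 d20 hd2] := c2 t Kt rt.
have /cvg_withinP/(_ _ e20)[d3 d30 hd3] := c3 t Kt rt.
have /cvg_withinP/(_ _ e20)[d4 d40 hd4] := c4 t Kt rt.
exists (Num.min d (Num.min (Num.min d1 d2) (Num.min d3 d4))).
  by rewrite !lt_min d0 d10 d20 d30.
move=> s Ks; rewrite !lt_min => /andP[sd /andP[/andP[s1 s2] /andP[s3 s4]]].
have {}s1 := hd1 s Ks s1; have {}s2 := hd2 s Ks s2.
have {}s3 := hd3 s Ks s3; have {}s4 := hd4 s Ks s4.
have B1 : `|f s (X' s) (V' s) - f s (X' t) (V' t)| <= B * (2 * e2).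
  by apply: le_trans (hB _ _ _ _ _ _ _ _ _ _) _; auto; rewrite ler_wpM2l//; lra.
have B2 : `|f s (X s) (V s) - f s (X t) (V t)| <= B * (2 * e2).
  by apply: le_trans (hB _ _ _ _ _ _ _ _ _ _) _; auto; rewrite ler_wpM2l//; lra.
have B3 : `|f s (X' t) (V' t) - f s (X t) (V t) - (f t (X' t) (V' t) - f t (X t) (V t))|
    <= e1 * (4 * M).
  apply: le_trans (hd t s _ _ _ _ _ _ _ _ _ _ _) _; auto.
  rewrite ler_wpM2l ?(ltW e10)//.
  have := ler_normB (X' t) (X t); have := ler_normB (V' t) (V t).
  by have := m1 t Kt; have := m2 t Kt; have := m3 t Kt; have := m4 t Kt; lra.
move: B1 B2 B3; rewrite !ler_norml => /andP[? ?] /andP[? ?] /andP[? ?].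
by apply/andP; split; lra.
Qed.

End lagrangian_increments.

(** * Constrained stationarity for functions of two real variables *)

(** At both ends [g] differs from the linear map of slope [B] by at most half the size of its value,
    so [g] has opposite signs there; the Lipschitz bound gives the continuity needed for a root. *)
Lemma first_order_root (R : realType) (g : R -> R) (B L c : R) : 0 < c -> B != 0 ->
  (forall v w, `|v| <= c -> `|w| <= c -> `|g v - g w| <= L * `|v - w|) ->
  `|g c - c * B| <= `|B| * c / 2 -> `|g (- c) - - c * B| <= `|B| * c / 2 ->
  exists2 v, `|v| <= c & g v = 0.
Proof.
move=> c0 B0 lipg gc gNc.
have cg : {within `[- c, c], continuous g}.
  apply/subspace_continuousP => v; rewrite /= in_itv /= -ler_norml => vc.
  apply/cvg_withinP => e e0; have L0 : 0 < `|L| + 1 by have := normr_ge0 L; lra.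
  exists (e / (`|L| + 1)); first exact: divr_gt0.
  move=> w; rewrite /= in_itv /= -ler_norml => wc.
  rewrite ltr_pdivlMr// => wv; apply: le_trans (lipg w v wc vc) _.
  by have := ler_wpM2r (normr_ge0 (w - v)) (ler_norm L); have := normr_ge0 (w - v); lra.
have cNc : - c <= c by lra.
suff /(IVT cNc cg)[v] : Num.min (g (- c)) (g c) <= 0 <= Num.max (g (- c)) (g c).
  by rewrite in_itv /= -ler_norml; exists v.
have Bc : 0 < `|B| * c by rewrite mulr_gt0// normr_gt0.
move: gc gNc; rewrite !ler_norml => /andP[? ?] /andP[? ?].
rewrite ge_min le_max; move: B0; rewrite neq_lt => /orP[Bn|Bp].
  have BE : c * B = - (`|B| * c) by rewrite ltr0_norm//; ring.
  by apply/andP; split; apply/orP; [right|left]; lra.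
have BE : c * B = `|B| * c by rewrite gtr0_norm//; ring.
by apply/andP; split; apply/orP; [left|right]; lra.
Qed.

(* For fixed small [u] the intermediate value theorem in [v] solves the
   constraint with [v = o(u)], so moving along [u] changes [F] to first order by
   [A1 * u]. *)
Lemma constrained_stationary (R : realType) (F G : R -> R -> R) (A1 A2 B2 : R) :
  (forall e, 0 < e -> exists2 d, 0 < d & forall u v, `|u| < d -> `|v| < d ->
     `|F u v - F 0 0 - (u * A1 + v * A2)| <= e * (`|u| + `|v|)) ->
  (forall e, 0 < e -> exists2 d, 0 < d & forall u v, `|u| < d -> `|v| < d ->
     `|G u v - G 0 0 - v * B2| <= e * (`|u| + `|v|)) ->
  (exists L, forall u v v', `|u| <= 1 -> `|v| <= 1 -> `|v'| <= 1 ->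
     `|G u v - G u v'| <= L * `|v - v'|) ->
  B2 != 0 ->
  (exists2 d, 0 < d & forall u v, `|u| < d -> `|v| < d -> G u v = G 0 0 ->
     F 0 0 <= F u v) ->
  A1 = 0.
Proof.
move=> dF dG [L lipG] B20 [d0 d00 minF]; apply/eqP/negPn/negP => A10.
have a0 : 0 < `|A1| by rewrite normr_gt0.
have b0 : 0 < `|B2| by rewrite normr_gt0.
have eF0 : 0 < `|A1| / 8 by lra.
(* The ratio [k] limits [|v|] to [k * |u|], so that the [A2] term spends at most a quarter of the
   gain [|A1| * |u|]. The remainder of [F], with rate [|A1| / 8] and [|v| <= |u|], spends another
   quarter. *)
have [k [k0 k1 kA]] : exists k, [/\ 0 < k, k <= 1 & k * `|A2| <= `|A1| / 4].
  have den : 0 < 4 * (`|A2| + 1) by have := normr_ge0 A2; lra.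
  exists (Num.min 1 (`|A1| / (4 * (`|A2| + 1)))); split.
  - by rewrite lt_min ltr01 divr_gt0.
  - by rewrite ge_min lexx.
  - set k := Num.min _ _.
    have : k <= `|A1| / (4 * (`|A2| + 1)) by rewrite ge_min lexx orbT.
    have : 0 < k by rewrite lt_min ltr01 divr_gt0.
    by clearbody k; rewrite ler_pdivlMr//; lra.
have [d1 d10 hF] := dF _ eF0.
(* Since [k <= 1], this rate gives an error of at most [|B2| * (k * x) / 2] when [|v| = k * x], the
   threshold of [first_order_root]. *)
have eG0 : 0 < `|B2| * k / 4 by have := mulr_gt0 b0 k0; lra.
have [d2 d20 hG] := dG _ eG0.
have [x [x0 xd0 x1 xd1 xd2]] : exists x, [/\ 0 < x, x < d0, x < 1, x < d1 & x < d2].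
  pose m := Num.min (Num.min d0 1) (Num.min d1 d2).
  have m0 : 0 < m by rewrite !lt_min d00 ltr01 d10.
  have : m / 2 < m by clearbody m; lra.
  rewrite !lt_min => /andP[/andP[? ?] /andP[? ?]].
  by exists (m / 2); split=> //; exact: divr_gt0.
have kx0 : 0 < k * x by exact: mulr_gt0.
have kxx : k * x <= x by rewrite ger_pMl.
(* The sign opposite to [A1] makes [F] decrease to first order, against minimality. *)
pose u := - Num.sg A1 * x.
have uN : `|u| = x by rewrite normrM normrN normr_sg A10 mul1r gtr0_norm.
have uA : u * A1 = - (`|A1| * x) by rewrite normrEsg /u; ring.
clearbody u.
have small (v : R) : `|v| <= k * x -> `|v| <= x by move=> vk; exact: le_trans kxx.
have [v vk Gv] : exists2 v, `|v| <= k * x & G u v - G 0 0 = 0.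
  have kxd : k * x < d2 by exact: le_lt_trans xd2.
  have est : `|B2| * k / 4 * (x + k * x) <= `|B2| * (k * x) / 2.
    by clear -eG0 kxx; have := ler_wpM2l (ltW eG0) kxx; lra.
  have hN (v : R) : `|v| = k * x -> `|G u v - G 0 0 - v * B2| <= `|B2| * (k * x) / 2.
    by move=> vN; have := hG u v; rewrite uN vN => /(_ xd2 kxd)/le_trans; apply.
  apply: (@first_order_root R (fun v => G u v - G 0 0) B2 L) => //.
  - move=> v w vk wk; rewrite (_ : _ - _ - _ = G u v - G u w); last by ring.
    by apply: lipG; rewrite ?uN; [exact: ltW| |];
      apply: le_trans (ltW x1); exact: small.
  - by apply: hN; rewrite gtr0_norm.
  - by apply: hN; rewrite normrN gtr0_norm.
move/eqP: Gv; rewrite subr_eq0 => /eqP Gv.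
have vx := small v vk.
have ud0 : `|u| < d0 by rewrite uN.
have vd0 : `|v| < d0 by exact: le_lt_trans xd0.
have := minF u v ud0 vd0 Gv.
have ud1 : `|u| < d1 by rewrite uN.
have vd1 : `|v| < d1 by exact: le_lt_trans xd1.
have := hF u v ud1 vd1; rewrite uN uA ler_norml => /andP[_ h1] h2.
have h3 : v * A2 <= `|A1| / 4 * x.
  apply: le_trans (ler_norm _) _; rewrite normrM.
  have := ler_wpM2r (normr_ge0 A2) vk; have := ler_wpM2r (ltW x0) kA; lra.
have h4 : `|A1| / 8 * (x + `|v|) <= `|A1| / 8 * (2 * x) by rewrite ler_wpM2l ?(ltW eF0)//; lra.
have := mulr_gt0 a0 x0; lra.
Qed.

(** * Variations of the functionals *)

Definition first_variation (R : realType) (T : set R) (a b : R)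
    (f : R -> R -> R -> R) (y w : R -> R) : R :=
  nabla_integral T a b (fun t =>
    along T a b (partial_x f) y t * w (rho T a b t) +
    along T a b (partial_v f) y t * nabla T a b w t).

(** The factors [1] make this an instance of the combination in [C1_lin] up to conversion. *)
Definition variation (R : realType) (y w1 w2 : R -> R) (u v t : R) : R :=
  1 * y t + 1 * (u * w1 t + v * w2 t).

Section variations.
Context {R : realType} {T : set R} {a b : R} (ts : ts_setting T a b).
Local Notation K := (kappa T a b).
Local Notation r := (rho T a b).
Local Notation ld := (ld_continuous T a b).
Local Notation int := (nabla_integral T a b).
Local Notation integrable := (nabla_integrable T a b).
Local Notation C1 := (C1_nabla T a b).
Local Notation D := (nabla T a b).

Lemma variation_C1 y w1 w2 u v : C1 y -> C1 w1 -> C1 w2 ->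
  C1 (variation y w1 w2 u v) /\
  forall t, K t -> D (variation y w1 w2 u v) t = D y t + (u * D w1 t + v * D w2 t).
Proof.
move=> C1y C1w1 C1w2; have [C1w dw] := C1_lin ts u v C1w1 C1w2.
have [C1z dz] := C1_lin ts 1 1 C1y C1w.
by split=> // t Kt; rewrite [LHS]dz// dw// !mul1r.
Qed.

Lemma variation_bound w1 w2 : C1 w1 -> C1 w2 ->
  exists2 C, 0 < C & forall u v t, K t ->
    `|u * w1 (r t) + v * w2 (r t)| <= C * (`|u| + `|v|) /\
    `|u * D w1 t + v * D w2 t| <= C * (`|u| + `|v|).
Proof.
move=> C1w1 C1w2.
have [[A1 h1] _] := C1_rho_ld_continuous ts C1w1.
have [[A2 h2] _] := C1_rho_ld_continuous ts C1w2.
have [[A3 h3] _] := C1_nabla_ld_continuous ts C1w1.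
have [[A4 h4] _] := C1_nabla_ld_continuous ts C1w2.
pose C := Num.max (Num.max A1 A2) (Num.max A3 A4).
exists (Num.max 1 C) => [|u v t Kt]; first by rewrite lt_max ltr01.
have le_C (x z : R) : `|x| <= C -> `|z| <= C ->
    `|u * x + v * z| <= Num.max 1 C * (`|u| + `|v|).
  move=> xC zC; apply: le_trans (ler_normD _ _) _; rewrite !normrM.
  have CC : C <= Num.max 1 C by rewrite le_max lexx orbT.
  have := ler_wpM2l (normr_ge0 u) (le_trans xC CC).
  have := ler_wpM2l (normr_ge0 v) (le_trans zC CC); lra.
split; apply: le_C; rewrite !le_max.
- by rewrite h1.
- by rewrite h2// orbT.
- by rewrite h3// !orbT.
- by rewrite h4// !orbT.
Qed.

Section functional_variation.
Context {f : R -> R -> R -> R} (hf : continuous_partials T a b f).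

Lemma along_partial_x_ld_continuous y : C1 y -> ld (along T a b (partial_x f) y).
Proof.
move=> C1y; apply: (ld_continuous_comp ts (partial_x_jointly_continuous hf)).
  exact: C1_rho_ld_continuous.
exact: C1_nabla_ld_continuous.
Qed.

Lemma along_partial_v_ld_continuous y : C1 y -> ld (along T a b (partial_v f) y).
Proof.
move=> C1y; apply: (ld_continuous_comp ts (partial_v_jointly_continuous hf)).
  exact: C1_rho_ld_continuous.
exact: C1_nabla_ld_continuous.
Qed.

Lemma first_variation_integrable y w : C1 y -> C1 w ->
  integrable (fun t => along T a b (partial_x f) y t * w (r t) +
                       along T a b (partial_v f) y t * D w t).
Proof.
move=> C1y C1w; apply: (ld_continuous_integrable ts); apply: ld_continuousD.
  apply: ld_continuousM; first exact: along_partial_x_ld_continuous.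
  exact: C1_rho_ld_continuous.
apply: ld_continuousM; first exact: along_partial_v_ld_continuous.
exact: C1_nabla_ld_continuous.
Qed.

Lemma first_variation_lin y w1 w2 c d : C1 y -> C1 w1 -> C1 w2 ->
  first_variation T a b f y (fun t => c * w1 t + d * w2 t) =
  c * first_variation T a b f y w1 + d * first_variation T a b f y w2.
Proof.
move=> C1y C1w1 C1w2; have i1 := first_variation_integrable C1y C1w1.
have i2 := first_variation_integrable C1y C1w2.
rewrite -(nabla_integral_lin ts)//; apply/esym/(eq_nabla_integral ts).
  by move=> t Kt; have [_ ->//] := C1_lin ts c d C1w1 C1w2; ring.
exact: nabla_integrable_lin.
Qed.

Lemma increment_integrable y z : C1 y -> C1 z ->
  integrable (fun t => along T a b f z t - along T a b f y t).
Proof.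
move=> C1y C1z; apply: (ld_continuous_integrable ts).
apply: (lagrangian_increment_ld_continuous ts hf); try exact: C1_rho_ld_continuous;
  exact: C1_nabla_ld_continuous.
Qed.

(** The integrand along [z] is the one along [y] plus an increment that always has an
    antiderivative, so integrability passes from [y] to every C1 function. This makes variations
    admissible as soon as they meet the constraint. *)
Lemma functional_increment y z : C1 y -> C1 z -> integrable (along T a b f y) ->
  integrable (along T a b f z) /\
  functional T a b f z - functional T a b f y =
    int (fun t => along T a b f z t - along T a b f y t).
Proof.
move=> C1y C1z iy; have iyz := increment_integrable C1y C1z.
have iz : integrable (along T a b f z).
  have [H hH] := nabla_integrable_lin ts 1 1 iy iyz.
  by exists H; apply: eq_antiderivative hH => t _; ring.
split=> //; rewrite /functional.
have -> : int (along T a b f z) - int (along T a b f y) =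
  1 * int (along T a b f z) + -1 * int (along T a b f y) by ring.
rewrite -(nabla_integral_lin ts)//; apply: (eq_nabla_integral ts).
  by move=> t _; ring.
exact: nabla_integrable_lin.
Qed.

Lemma functional_taylor y e : C1 y -> integrable (along T a b f y) -> 0 < e ->
  exists2 d, 0 < d & forall w1 w2 u v m, C1 w1 -> C1 w2 -> m < d ->
    (forall t, K t -> `|u * w1 (r t) + v * w2 (r t)| <= m /\
                      `|u * D w1 t + v * D w2 t| <= m) ->
    `|functional T a b f (variation y w1 w2 u v) - functional T a b f y -
      (u * first_variation T a b f y w1 + v * first_variation T a b f y w2)| <= e * m.
Proof.
move=> C1y iy e0; have ab0 : 0 < b - a by rewrite subr_gt0; exact: ts_lt ts.
have [[A h1] _] := C1_rho_ld_continuous ts C1y.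
have [[B h2] _] := C1_nabla_ld_continuous ts C1y.
(* The pointwise remainder is at most [e1 * (2 * m)]; integrated over a length [b - a] it becomes
   [e * m]. *)
pose M := Num.max A B; pose e1 := e / (2 * (b - a)).
have e10 : 0 < e1 by rewrite divr_gt0//; lra.
have e1E : e1 * (2 * (b - a)) = e by rewrite divfK// gt_eqF//; lra.
have [d d0 hd] := lagrangian_taylor ts hf M e10.
exists d => // w1 w2 u v m C1w1 C1w2 md hm; set z := variation y w1 w2 u v.
have [C1z dz] := variation_C1 u v C1y C1w1 C1w2.
have [_ ->] := functional_increment C1y C1z iy.
rewrite -first_variation_lin//; set w := fun t => u * w1 t + v * w2 t.
have [C1w dw] := C1_lin ts u v C1w1 C1w2.
have i1 := increment_integrable C1y C1z.
have i2 := first_variation_integrable C1y C1w.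
rewrite -[X in X - _]mul1r -mulN1r -(nabla_integral_lin ts)//.
have := nabla_integral_norm_le ts (M := e1 * (2 * m)) (nabla_integrable_lin ts 1 (-1) i1 i2).
rewrite (_ : e1 * (2 * m) * (b - a) = e * m); last by rewrite -e1E; ring.
apply => t Kt; have [wm dwm] := hm t Kt.
have wd := le_lt_trans wm md; have dwd := le_lt_trans dwm md.
have yM : `|y (r t)| <= M by rewrite le_max h1.
have dyM : `|D y t| <= M by rewrite le_max h2// orbT.
have := hd t _ _ _ _ (kappa_ts_itv ts Kt) yM dyM wd dwd.
rewrite mul1r mulN1r dw// /along dz// /z /variation !mul1r => /le_trans; apply.
by rewrite ler_wpM2l ?(ltW e10)//; lra.
Qed.

Lemma functional_variation_expansion y w1 w2 : C1 y -> integrable (along T a b f y) ->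
  C1 w1 -> C1 w2 ->
  forall e, 0 < e -> exists2 d, 0 < d & forall u v, `|u| < d -> `|v| < d ->
    `|functional T a b f (variation y w1 w2 u v) - functional T a b f y -
      (u * first_variation T a b f y w1 + v * first_variation T a b f y w2)|
        <= e * (`|u| + `|v|).
Proof.
move=> C1y iy C1w1 C1w2 e e0; have [C C0 hC] := variation_bound C1w1 C1w2.
have eC0 : 0 < e / C by exact: divr_gt0.
have [d d0 hd] := functional_taylor C1y iy eC0.
exists (d / (2 * C)) => [|u v]; first by rewrite divr_gt0//; lra.
rewrite !ltr_pdivlMr; [|lra..] => ud vd.
have := hd w1 w2 u v (C * (`|u| + `|v|)) C1w1 C1w2.
by rewrite mulrA divfK ?gt_eqF//; apply=> [|t Kt]; [lra|exact: hC].
Qed.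

Lemma functional_variation_lipschitz y w1 w2 : C1 y -> integrable (along T a b f y) ->
  C1 w1 -> C1 w2 ->
  exists L, forall u v v', `|u| <= 1 -> `|v| <= 1 -> `|v'| <= 1 ->
    `|functional T a b f (variation y w1 w2 u v) -
      functional T a b f (variation y w1 w2 u v')| <= L * `|v - v'|.
Proof.
move=> C1y iy C1w1 C1w2; have ab0 : 0 < b - a by rewrite subr_gt0; exact: ts_lt ts.
have [C C0 hC] := variation_bound C1w1 C1w2.
have [[A h1] _] := C1_rho_ld_continuous ts C1y.
have [[B h2] _] := C1_nabla_ld_continuous ts C1y.
(* For [u] and [v] of size at most [1] the perturbation is at most [C * 2], so all variations
   concerned stay in the box of radius [M]. *)
pose M := Num.max A B + C * 2.
have [L L0 hL] := lagrangian_lipschitz ts hf M.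
exists (L * (2 * C) * (b - a)) => u v v' u1 v1 v'1.
have [C1z dz] := variation_C1 u v C1y C1w1 C1w2.
have [C1z' dz'] := variation_C1 u v' C1y C1w1 C1w2.
have [iz' _] := functional_increment C1y C1z' iy.
have [_ ->] := functional_increment C1z' C1z iz'.
rewrite mulrAC.
apply: (nabla_integral_norm_le ts); first exact: increment_integrable.
have bnd (x z : R) : `|z| <= C * (`|u| + `|x|) -> `|x| <= 1 -> `|z| <= C * 2.
  by move=> h ?; apply: le_trans h _; rewrite ler_wpM2l ?(ltW C0)//; lra.
have yM t : K t -> `|y (r t)| <= Num.max A B by move=> Kt; rewrite le_max h1.
have dyM t : K t -> `|D y t| <= Num.max A B by move=> Kt; rewrite le_max h2// orbT.
have addM (x z : R) : `|x| <= Num.max A B -> `|z| <= C * 2 -> `|x + z| <= M.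
  by move=> ? ?; apply: le_trans (ler_normD _ _) _; rewrite lerD.
move=> t Kt; have [p1 q1] := hC u v t Kt; have [p2 q2] := hC u v' t Kt.
(* Two variations with the same [u] differ by [(v - v')] times [w2], which is the variation with
   parameters [0] and [v - v']. *)
have [p3 q3] := hC 0 (v - v') t Kt.
rewrite normr0 add0r !mul0r !add0r in p3 q3.
rewrite /along dz// dz'// /variation !mul1r.
apply: le_trans (hL t _ _ _ _ (kappa_ts_itv ts Kt) _ _ _ _) _.
- by apply: addM (yM t Kt) _; exact: bnd p2 v'1.
- by apply: addM (dyM t Kt) _; exact: bnd q2 v'1.
- by apply: addM (yM t Kt) _; exact: bnd p1 v1.
- by apply: addM (dyM t Kt) _; exact: bnd q1 v1.
rewrite -!mulrA ler_wpM2l//.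
rewrite (_ : _ - _ = (v - v') * w2 (r t)); last by ring.
rewrite (_ : D y t + _ - _ = (v - v') * D w2 t); last by ring.
lra.
Qed.

End functional_variation.
End variations.

(** * Multipliers and the Euler-Lagrange equation *)

Section euler_lagrange.
Context {R : realType} {T : set R} {a b : R} (ts : ts_setting T a b).
Context {f g : R -> R -> R -> R}.
Context (hf : continuous_partials T a b f) (hg : continuous_partials T a b g).
Local Notation I := (ts_itv T a b).
Local Notation K := (kappa T a b).
Local Notation r := (rho T a b).
Local Notation anti := (nabla_antiderivative T a b).
Local Notation ld := (ld_continuous T a b).
Local Notation C1 := (C1_nabla T a b).
Local Notation D := (nabla T a b).

Lemma derive1_lin (h k : R -> R) (x dh dk c d : R) :
  is_derive x 1 h dh -> is_derive x 1 k dk ->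
  derive1 (fun z => c * h z - d * k z) x = c * dh - d * dk.
Proof.
move=> hx kx; rewrite derive1E.
have hZ := @is_deriveZ R R^o R^o h c x 1 dh hx.
have kZ := @is_deriveZ R R^o R^o k d x 1 dk kx.
have hk : is_derive x 1 (fun z => c * h z - d * k z) (c * dh - d * dk) :=
  is_deriveB hZ kZ.
by case: hk.
Qed.

Lemma partial_x_lin (c d t x v : R) : I t ->
  partial_x (fun t x v => c * f t x v - d * g t x v) t x v =
  c * partial_x f t x v - d * partial_x g t x v.
Proof.
move=> It.
exact: derive1_lin (is_derive_partial_x hf x v It) (is_derive_partial_x hg x v It).
Qed.

Lemma partial_v_lin (c d t x v : R) : I t ->
  partial_v (fun t x v => c * f t x v - d * g t x v) t x v =
  c * partial_v f t x v - d * partial_v g t x v.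
Proof.
move=> It.
exact: derive1_lin (is_derive_partial_v hf x v It) (is_derive_partial_v hg x v It).
Qed.

Lemma nabla_norm_le (h : R -> R) (M : R) : (forall t, K t -> `|h t| <= M) ->
  nabla_norm T a b h <= M.
Proof.
move=> hM; apply: ge_sup; last by move=> _ [t Kt <-]; exact: hM.
by exists (`|h b|); exists b; [exact: (kappa_b ts)|].
Qed.

Lemma local_extremum_stationary (alpha beta Lambda : R) (y w1 w2 : R -> R) :
  local_minimizer T a b alpha beta Lambda f g y \/
  local_maximizer T a b alpha beta Lambda f g y ->
  C1 w1 -> w1 a = 0 -> w1 b = 0 -> C1 w2 -> w2 a = 0 -> w2 b = 0 ->
  first_variation T a b g y w1 = 0 -> first_variation T a b g y w2 != 0 ->
  first_variation T a b f y w1 = 0.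
Proof.
move=> hy C1w1 w1a w1b C1w2 w2a w2b gw1 gw2.
have [C1y [ya yb] iyf iyg gy] : admissible T a b alpha beta Lambda f g y.
  by case: hy => [[]|[]].
have var0 : variation y w1 w2 0 0 = y.
  by apply/funext => t; rewrite /variation !mul0r addr0 mulr0 addr0 mul1r.
have [C C0 hC] := variation_bound ts C1w1 C1w2.
(* Both norms in [C1_dist] are at most [C * (|u| + |v|)], each less than [delta / 2] under these
   bounds. *)
have close u v delta : 0 < delta -> `|u| < delta / (4 * C) -> `|v| < delta / (4 * C) ->
    C1_dist T a b (variation y w1 w2 u v) y < delta.
  move=> delta0; rewrite !ltr_pdivlMr; [|lra..] => ud vd.
  have [_ dz] := variation_C1 ts u v C1y C1w1 C1w2.
  rewrite /C1_dist.
  have n1 : nabla_norm T a b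
      (fun t => variation y w1 w2 u v (r t) - y (r t)) <= C * (`|u| + `|v|).
    apply: nabla_norm_le => t Kt; have [h _] := hC u v t Kt.
    by rewrite /variation !mul1r addrC addKr.
  have n2 : nabla_norm T a b
      (fun t => D (variation y w1 w2 u v) t - D y t) <= C * (`|u| + `|v|).
    apply: nabla_norm_le => t Kt; have [_ h] := hC u v t Kt.
    by rewrite dz// addrC addKr.
  by apply: le_lt_trans (lerD n1 n2) _; lra.
have adm u v : functional T a b g (variation y w1 w2 u v) =
      functional T a b g (variation y w1 w2 0 0) ->
    admissible T a b alpha beta Lambda f g (variation y w1 w2 u v).
  rewrite var0 gy => gz; have [C1z _] := variation_C1 ts u v C1y C1w1 C1w2.
  split=> //.
  - by rewrite /variation w1a w2a w1b w2b ya yb !(mulr0, addr0, mul1r).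
  - by case: (functional_increment ts hf C1y C1z iyf).
  - by case: (functional_increment ts hg C1y C1z iyg).
pose F u v := functional T a b f (variation y w1 w2 u v).
pose G u v := functional T a b g (variation y w1 w2 u v).
have dG e : 0 < e -> exists2 d, 0 < d & forall u v, `|u| < d -> `|v| < d ->
    `|G u v - G 0 0 - v * first_variation T a b g y w2| <= e * (`|u| + `|v|).
  move=> /(functional_variation_expansion ts hg C1y iyg C1w1 C1w2)[d d0 hd].
  by exists d => // u v ud vd; rewrite /G var0; have := hd u v ud vd; rewrite gw1 mulr0 add0r.
have dF e : 0 < e -> exists2 d, 0 < d & forall u v, `|u| < d -> `|v| < d ->
    `|F u v - F 0 0 - (u * first_variation T a b f y w1 +
       v * first_variation T a b f y w2)| <= e * (`|u| + `|v|).
  move=> /(functional_variation_expansion ts hf C1y iyf C1w1 C1w2)[d d0 hd].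
  by exists d => // u v ud vd; rewrite /F var0; exact: hd.
have lipG := functional_variation_lipschitz ts hg C1y iyg C1w1 C1w2.
case: hy => -[_ [delta [delta0 opt]]].
  apply: (constrained_stationary dF dG lipG gw2).
  exists (delta / (4 * C)) => [|u v ud vd /adm admz]; first by rewrite divr_gt0//; lra.
  by rewrite /F var0; apply: opt => //; exact: close.
(* A maximizer is treated as a minimizer of [- F] under the same constraint. *)
apply/eqP; rewrite -oppr_eq0; apply/eqP.
apply: (@constrained_stationary R (fun u v => - F u v) G _
  (- first_variation T a b f y w2) (first_variation T a b g y w2)) => //.
  move=> e /dF[d d0 hd]; exists d => // u v ud vd.
  by rewrite !mulrN -!opprD normrN; exact: hd.
exists (delta / (4 * C)) => [|u v ud vd /adm admz]; first by rewrite divr_gt0//; lra.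
by rewrite /F var0 lerN2; apply: opt => //; exact: close.
Qed.

Lemma multipliers_exist (alpha beta Lambda : R) (y : R -> R) :
  local_minimizer T a b alpha beta Lambda f g y \/
  local_maximizer T a b alpha beta Lambda f g y ->
  exists c d : R, ~ (c = 0 /\ d = 0) /\
    forall w, C1 w -> w a = 0 -> w b = 0 ->
      c * first_variation T a b f y w - d * first_variation T a b g y w = 0.
Proof.
move=> hy; have C1y : C1 y by case: hy => [[[]]|[[]]].
have [g0|] := pselect (forall w, C1 w -> w a = 0 -> w b = 0 ->
  first_variation T a b g y w = 0).
  (* The abnormal case: [y] is stationary for the constraint itself, and the multiplier of [f] is
     zero. *)
  exists 0, 1; split=> [[_ /eqP]|w C1w wa wb]; first by rewrite oner_eq0.
  by rewrite g0// mul0r mulr0 subr0.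
move=> /existsNP[w2 /not_implyP[C1w2 /not_implyP[w2a /not_implyP[w2b /eqP gw2]]]].
exists 1, (first_variation T a b f y w2 / first_variation T a b g y w2).
split=> [[/eqP]|w C1w wa wb]; first by rewrite oner_eq0.
(* Adding [s] times [w2] to [w] cancels the first variation of the constraint; stationarity along
   the result says that the two first variations at [w] are in the ratio found at [w2]. *)
pose s := - (first_variation T a b g y w / first_variation T a b g y w2).
have [C1w1 _] := C1_lin ts 1 s C1w C1w2.
have := local_extremum_stationary hy C1w1 _ _ C1w2 w2a w2b _ gw2.
rewrite !first_variation_lin// wa wb w2a w2b !mulr0 addr0 => /(_ erefl erefl).
move: gw2; rewrite /s.
move: (first_variation T a b f y w) (first_variation T a b f y w2).
move: (first_variation T a b g y w) (first_variation T a b g y w2) => C E A B E0.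
by rewrite !mulNr divfK// mul1r subrr => /(_ erefl); rewrite mul1r; lra.
Qed.

Lemma euler_lagrange_of_first_variation (y : R -> R) (c d : R) : C1 y ->
  (forall w, C1 w -> w a = 0 -> w b = 0 ->
     c * first_variation T a b f y w - d * first_variation T a b g y w = 0) ->
  euler_lagrange T a b (fun t x v => c * f t x v - d * g t x v) y.
Proof.
move=> C1y fv0.
pose kx t := c * along T a b (partial_x f) y t - d * along T a b (partial_x g) y t.
pose kv t := c * along T a b (partial_v f) y t - d * along T a b (partial_v g) y t.
have ldlin (p q : R -> R) : ld p -> ld q -> ld (fun t => c * p t - d * q t).
  move=> ldp ldq.
  apply: (@eq_ld_continuous _ _ _ _ (fun t => c * p t + (- d) * q t)).
    by move=> t _; rewrite mulNr.
  by apply: ld_continuousD; apply: ld_continuousM => //; exact: ld_continuous_cst.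
have ldkx : ld kx by apply: ldlin; exact: along_partial_x_ld_continuous.
have ldkv : ld kv by apply: ldlin; exact: along_partial_v_ld_continuous.
have [G dG] := ld_continuous_integrable ts ldkx.
have ldG := antiderivative_ld_continuous ts ldkx dG.
have ldphi : ld (fun t => kv t + -1 * G t).
  by apply: ld_continuousD => //; apply: ld_continuousM => //; exact: ld_continuous_cst.
have [|e kvE] := dubois_reymond ts ldphi.
  move=> w C1w wa wb; have := fv0 w C1w wa wb.
  have if_ := first_variation_integrable ts hf C1y C1w.
  have ig := first_variation_integrable ts hg C1y C1w.
  rewrite -mulNr -(nabla_integral_lin ts)//.
  have [P dP] := nabla_integrable_lin ts c (- d) if_ ig.
  rewrite (nabla_integralE ts dP) => P0.
  (* Integration by parts: the derivative of [G * w] is [kx t * w (r t) + G t * D w t], so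
     subtracting it removes the [kx] term, and the boundary terms vanish with [w]. *)
  have dE : anti (fun t => (kv t + -1 * G t) * D w t) (fun t => P t + -1 * (G t * w t)).
    move=> t Kt; have It := kappa_ts_itv ts Kt.
    have := nabla_derivativeD (dP t Kt) (nabla_derivativeZ (-1) It
      (nabla_derivativeM It (dG t Kt) (C1_antiderivative C1w Kt))).
    congr (is_nabla_derivative _ _ _ _ _ _); rewrite /kv /kx; ring.
  by rewrite (nabla_integralE ts dE) wa wb !mulr0 !addr0.
(* The value supplied at a right-scattered [a] makes [Kv = G + e] hold on all of [I], in particular
   at [a = rho (sigma a)], which the derivative at [sigma a] involves. *)
exists (G a + e) => t Kt; have It := kappa_ts_itv ts Kt.
set Kv := extend_to_a _ _ _ _ _.
have KvE s : I s -> Kv s = G s + e.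
  move=> Is; rewrite /Kv /extend_to_a; case: ifPn => [|/negP].
    rewrite inE => Ks; rewrite /along partial_v_lin//.
    by have := kvE s Ks; rewrite /kv /along; lra.
  by rewrite inE => /(notin_kappa ts Is) ->.
have dKv : is_nabla_derivative T a b Kv t (kx t).
  apply: (nabla_derivative_eq ts (h := fun s => G s + e)) => //.
    by move=> s /KvE.
  by rewrite -[kx t]addr0; apply: nabla_derivativeD; [exact: dG|exact: nabla_derivative_cst].
split; first by exists (kx t).
by rewrite (nablaE ts Kt dKv) /along partial_x_lin// subrr.
Qed.

End euler_lagrange.

Theorem theorem2 (R : realType) (T : set R) (a b alpha beta Lambda : R)
    (f g : R -> R -> R -> R) (y : R -> R)
    (hT : time_scale T) (ha : T a) (hb : T b) (hab : a < b)
    (hf : continuous_partials T a b f) (hg : continuous_partials T a b g)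
    (hy : local_minimizer T a b alpha beta Lambda f g y \/
          local_maximizer T a b alpha beta Lambda f g y) :
  exists lambda0 lambda : R,
    ~ (lambda0 = 0 /\ lambda = 0) /\
    euler_lagrange T a b
      (fun t x v => lambda0 * f t x v - lambda * g t x v) y.
Proof.
have ts : ts_setting T a b by split=> //; case: hT.
have C1y : C1_nabla T a b y by case: hy => [[[]]|[[]]].
have [c [d [cd fv0]]] := multipliers_exist ts hf hg hy.
exists c, d; split=> //.
exact: (euler_lagrange_of_first_variation ts hf hg C1y fv0).
Qed.
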